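(* Let $s\ge 2$ be even and let $\boldsymbol{\xi}=\{\xi_n\}_{n\ge0}$ be an environment of independent random variables such that (a) there exist a constant $c>0$ and a function $g:\mathbb{N}\setminus\{0\}\to(0,\infty)$ with $\sum_{n\ge1}1/g(n)=\infty$ and $P\big(\limsup_{n\to\infty}S_n/g(n)\le c\big)=1$; and (b) $\inf_{n}P(\xi_n\ge1)=\kappa>0$. Then the $(s,\boldsymbol{\xi})$-TBRW is null recurrent (for every initial state $(T_0,x_0)$ with $T_0$ a finite tree having a self-loop at its root).
   Context: **Tree Builder Random Walk (TBRW).** Parameters: an integer $s\ge1$ and an environment $\boldsymbol{\xi}=\{\xi_n\}_{n\ge0}$, a sequence of non-negative integer valued random variables with law $P$. The initial state is $(T_0,x_0)$, where here $T_0$ is a finite tree with a distinguished vertex, the root, which is the unique vertex carrying a self-loop (a single vertex with a self-loop is allowed), and $x_0\in V(T_0)$. Given a realization of $\boldsymbol{\xi}$, set $X_0=x_0$ and define inductively for $n\ge 0$: (1) if $n\equiv 0 \pmod s$, $T_{n+1}$ is obtained from $T_n$ by attaching $\xi_n$ new leaves to $X_n$; otherwise $T_{n+1}=T_n$; (2) choose uniformly at random (independently of everything else given the past and $\boldsymbol{\xi}$) one of the edges of $T_{n+1}$ incident to $X_n$ (a self-loop counts as one edge), and let $X_{n+1}$ be its other endpoint ($X_{n+1}=X_n$ if the self-loop is chosen). The law and expectation are $\mathbb{P}_{T_0,x_0,s,\boldsymbol{\xi}}$, $\mathbb{E}_{T_0,x_0,s,\boldsymbol{\xi}}$. **Notation.**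 $S_n:=\sum_{j=1}^n\xi_{sj}$. **Recurrence.** The TBRW started from $(T_0,x_0)$ is recurrent if for every $n\ge0$, every pair $(\widetilde T,x)$ attained by $(T_n,X_n)$ with positive probability and every $z\in V(\widetilde T)$, $\mathbb{P}_{T_0,x_0,s,\boldsymbol{\xi}}\big(X_m=z\text{ for infinitely many } m\,\big|\,T_n=\widetilde T,X_n=x\big)=1$. It is positive recurrent if it is recurrent and for all such $n$, $(\widetilde T,x)$ and $z$, the conditional expectation, given $T_n=\widetilde T$, $X_n=x$, of $\inf\{m\ge1: X_{n+m}=z\}$ is finite. It is null recurrent if it is recurrent but not positive recurrent. *)

(* Defs.v *)
From HB Require Import structures.
From mathcomp Require Import all_boot all_order all_algebra.
From mathcomp Require Import finmap.
From mathcomp Require Import all_classical all_reals all_analysis.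

Set Implicit Arguments.
Unset Strict Implicit.
Unset Printing Implicit Defensive.

Import Order.TTheory GRing.Theory Num.Theory.
Import numFieldNormedType.Exports.

Local Open Scope classical_set_scope.
Local Open Scope ring_scope.

(** * Finite graphs and rooted trees *)

(** A finite graph on the vertices [0, ..., nverts - 1].  An undirected edge
    [uv] with [u <> v] is stored as the two pairs [(u, v)] and [(v, u)]; a
    self-loop at [u] is the single pair [(u, u)].  Hence the edges incident to
    [u] correspond one-to-one to the second components of the pairs [(u, _)],
    a self-loop counting once. *)
Record graph := Graph { nverts : nat; edges : {fset (nat * nat)} }.

Definition adj (G : graph) : rel nat := fun u v => (u, v) \in edges G.

Definition nbrs (G : graph) (u : nat) : seq nat :=
  [seq v <- iota 0 (nverts G) | adj G u v].

Definition degree (G : graph) (u : nat) : nat := size (nbrs G u).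

Definition is_graph (G : graph) : Prop :=
  (forall u v, adj G u v -> (u < nverts G)%N /\ (v < nverts G)%N)
  /\ symmetric (adj G).

Definition connected_graph (G : graph) : Prop :=
  forall u v, (u < nverts G)%N -> (v < nverts G)%N ->
    exists2 p, path (adj G) u p & last u p = v.

(** [ucycle] also accepts the one-vertex cycle around a self-loop and the
    back-and-forth cycle [u, v] along an edge; the cycles of graph theory are
    the ones with at least three vertices. *)
Definition acyclic_graph (G : graph) : Prop :=
  forall c, ucycle (adj G) c -> (size c <= 2)%N.

Definition is_rooted_tree (G : graph) : Prop :=
  [/\ is_graph G, connected_graph G, acyclic_graph G &
      exists2 r, (r < nverts G)%N & forall u, adj G u u = (u == r)].

(** The new leaves are the vertices [nverts G, ..., nverts G + k - 1]. *)
Definition attach (G : graph) (x k : nat) : graph :=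
  Graph (nverts G + k)
    (edges G `|` [fset (x, v) | v in iota (nverts G) k]
             `|` [fset (v, x) | v in iota (nverts G) k])%fset.

(** * The tree builder random walk *)

(** The tree [T_n], as a function of [T_0], of the numbers of leaves
    [k 0, k 1, ...] and of the positions [x 0, x 1, ...] of the walker. *)
Fixpoint tree_at (s : nat) (T0 : graph) (k x : nat -> nat) (n : nat) : graph :=
  if n is m.+1 then
    let T := tree_at s T0 k x m in
    if (s %| m)%N then attach T (x m) (k m) else T
  else T0.

Definition step_prob (R : realType) (G : graph) (u v : nat) : R :=
  (v \in nbrs G u)%:R / (degree G u)%:R.

Definition mutually_independent (R : realType) (d : measure_display)
    (Omega : measurableType d) (P : probability Omega R)
    (xi : nat -> {RV P >-> nat}) : Prop :=
  forall (J : {fset nat}) (A : nat -> set nat),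
    P (\bigcap_(j in [set` J]) (xi j @^-1` A j)) =
    (\prod_(j <- J) P (xi j @^-1` A j))%E.

Section TBRW.
Context (R : realType) (d : measure_display) (Omega : measurableType d).
Context (P : probability Omega R).
Implicit Types (xi X : nat -> {RV P >-> nat}).

Definition cylinder X (n : nat) (x : nat -> nat) : set Omega :=
  [set w | forall i, (i <= n)%N -> X i w = x i].

(** [X] is the walker of the TBRW driven by the environment [xi].  All
    variables being discrete, the conditional law of [X_{n+1}] given the past
    [X_0, ..., X_n] and the whole of [xi] is prescribed by conditioning on
    [X_0, ..., X_n] and [xi_0, ..., xi_m] for every [m >= n]; the requirement
    [n <= m] makes [T_{n+1}] a function of the conditioning values. *)
Definition is_TBRW (s : nat) (T0 : graph) (x0 : nat) xi X : Prop :=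
  P [set w | X 0%N w = x0] = 1%E
  /\ forall (n m : nat) (k x : nat -> nat) (y : nat), (n <= m)%N ->
       P (cylinder xi m k `&` cylinder X n x `&` [set w | X n.+1 w = y]) =
       (P (cylinder xi m k `&` cylinder X n x) *
        (step_prob R (tree_at s T0 k x n.+1) (x n) y)%:E)%E.

Definition tree_proc (s : nat) (T0 : graph) xi X (n : nat) (w : Omega) : graph :=
  tree_at s T0 (fun i => xi i w) (fun i => X i w) n.

Definition state_event (s : nat) (T0 : graph) xi X (n : nat) (T : graph) (x : nat) :
    set Omega :=
  [set w | tree_proc s T0 xi X n w = T /\ X n w = x].

Definition cond_prob (A B : set Omega) : R := fine (P (A `&` B)) / fine (P B).

(** Conditional expectation of a nonnegative [f] given an event [B] of
    positive probability. *)
Definition cond_expectation (f : Omega -> \bar R) (B : set Omega) : \bar R :=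
  ((\int[P]_(w in B) f w) * ((fine (P B))^-1)%:E)%E.

Definition visits_infinitely_often X (z : nat) : set Omega :=
  [set w | infinite_set [set m | X m w = z]].

(** [ereal_inf set0 = +oo]: the value is [+oo] if [z] is never reached. *)
Definition hitting_time X (n z : nat) (w : Omega) : \bar R :=
  ereal_inf [set (m%:R)%:E | m in [set m | (1 <= m)%N /\ X (n + m)%N w = z]].

Definition recurrent (s : nat) (T0 : graph) xi X : Prop :=
  forall (n : nat) (T : graph) (x z : nat),
    (0 < P (state_event s T0 xi X n T x))%E -> (z < nverts T)%N ->
    cond_prob (visits_infinitely_often X z) (state_event s T0 xi X n T x) = 1.

Definition positive_recurrent (s : nat) (T0 : graph) xi X : Prop :=
  recurrent s T0 xi X /\
  forall (n : nat) (T : graph) (x z : nat),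
    (0 < P (state_event s T0 xi X n T x))%E -> (z < nverts T)%N ->
    (cond_expectation (hitting_time X n z) (state_event s T0 xi X n T x)
       < +oo)%E.

Definition null_recurrent (s : nat) (T0 : graph) xi X : Prop :=
  recurrent s T0 xi X /\ ~ positive_recurrent s T0 xi X.

(** [S_n = xi_s + xi_{2s} + ... + xi_{ns}] *)
Definition env_sum (s : nat) xi (n : nat) (w : Omega) : nat :=
  (\sum_(1 <= j < n.+1) xi (s * j)%N w)%N.

End TBRW.

(* Main.v *)
Require Import Defs.
From HB Require Import structures.
From mathcomp Require Import all_boot all_order all_algebra.
From mathcomp Require Import finmap ring lra zify.
From mathcomp Require Import all_classical all_reals all_analysis measurable_realfun.

Set Implicit Arguments.
Unset Strict Implicit.
Unset Printing Implicit Defensive.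

Import Order.TTheory GRing.Theory Num.Theory.
Import numFieldNormedType.Exports.

Local Open Scope classical_set_scope.
Local Open Scope ring_scope.

(** Recurrence.  If two edges leave the same vertex, each step from that vertex
    uses them with equal probability, so a supermartingale argument shows that
    one of them is used infinitely often as soon as the other is.  Edges of a
    tree being bridges, an edge crossed infinitely often is also crossed
    infinitely often in the other direction, and the property spreads to the
    whole tree.  It remains to start the propagation: if the loop were not used
    after some time [n], the parity of [s] would force the walker to be, at all
    later growth times, in the finite tree [T_n], at a vertex of degree at most
    [C + S_j]; since [sum_j 1 / (C + S_j) = oo], some vertex [u] has divergent
    total crossing rates, hence all its edges are crossed infinitely often and
    the loop is used after all.

    Non-positivity.  With positive probability the walker reaches a vertex [a]
    at a large height [D] all of whose neighbours but one are leaves.  Let [h]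
    vanish at the root [r] and be harmonic off [r] and [a], with [h a = D].  At
    each growth visit to [a] the degree of [a] increases by at least one with
    probability [kappa], while a visit to [a] decreases the mean of [h] only by
    [1 / degree a].  Hence [h (X_m)] times the number of growths of [a], killed
    at [r], does not decrease in mean when [kappa * D >= 2 ^ (s + 1)].  As it is
    at most [D * (m + 1)], the probability of avoiding [r] up to time [m] is
    bounded below by a multiple of [1 / m], and the mean hitting time of [r] is
    infinite. *)

(** * Trees whose edges are bridges *)

Lemma mem_nbrs G u v : (v \in nbrs G u) = (v < nverts G)%N && adj G u v.
Proof. by rewrite mem_filter mem_iota add0n /= andbC. Qed.

Lemma nbrs_adj G u v : is_graph G -> (v \in nbrs G u) = adj G u v.
Proof.
move=> [bG _]; rewrite mem_nbrs; case: (boolP (adj G u v)) => [/bG[_ ->]//|].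
by rewrite andbF.
Qed.

Lemma uniq_nbrs G u : uniq (nbrs G u).
Proof. by rewrite filter_uniq // iota_uniq. Qed.

Lemma degree_le_nverts G u : (degree G u <= nverts G)%N.
Proof.
by rewrite /degree /nbrs size_filter (leq_trans (count_size _ _)) // size_iota.
Qed.

Lemma adj_attach G x k u v : adj (attach G x k) u v =
  [|| adj G u v, (u == x) && (nverts G <= v < nverts G + k)%N
    | (v == x) && (nverts G <= u < nverts G + k)%N].
Proof.
rewrite /adj /attach /= !in_fsetU -orbA; congr [|| _, _ | _].
- apply/imfsetP/andP => [[w /=]|[/eqP -> hv]].
    by rewrite mem_iota => hw [-> ->].
  by exists v => //=; rewrite mem_iota.
- apply/imfsetP/andP => [[w /=]|[/eqP -> hv]].
    by rewrite mem_iota => hw [-> ->].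
  by exists u => //=; rewrite mem_iota.
Qed.

Lemma adj_attach_old G x k u v :
  (u < nverts G)%N -> (v < nverts G)%N -> adj (attach G x k) u v = adj G u v.
Proof.
move=> hu hv; rewrite adj_attach (leqNgt _ v) hv (leqNgt _ u) hu /=.
by rewrite !andbF !orbF.
Qed.

Lemma nbrs_attach G x k u : is_graph G -> (x < nverts G)%N -> (u < nverts G)%N ->
  nbrs (attach G x k) u = nbrs G u ++ (if u == x then iota (nverts G) k else [::]).
Proof.
move=> [bG _] hx hu; rewrite /nbrs /= iotaD add0n filter_cat; congr (_ ++ _).
  by apply: eq_in_filter => v; rewrite mem_iota add0n /= => hv; rewrite adj_attach_old.
case: eqVneq => [->|nux].
  apply/all_filterP/allP => v; rewrite mem_iota => hv.
  by rewrite adj_attach eqxx hv /= orbT.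
rewrite (@eq_in_filter _ _ pred0) ?filter_pred0 // => v; rewrite mem_iota => /andP[hv _].
rewrite adj_attach (negbTE nux) /= (gtn_eqF (leq_trans hx hv)) /= orbF.
by apply/negbTE/negP => /bG [_ hv']; rewrite leqNgt hv' in hv.
Qed.

Lemma nbrs_attach_new G x k u : is_graph G -> (x < nverts G)%N ->
  (nverts G <= u < nverts G + k)%N -> nbrs (attach G x k) u = [:: x].
Proof.
move=> [bG sG] hx /andP[hu hu']; rewrite /nbrs.
rewrite (@eq_in_filter _ _ (pred1 x)) => [|v].
  by rewrite filter_pred1_uniq ?iota_uniq // mem_iota add0n (leq_trans hx) ?leq_addr.
rewrite mem_iota add0n => /= hv; rewrite adj_attach hu hu' andbT.
rewrite (gtn_eqF (leq_trans hx hu)) /=.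
have /negbTE -> : ~~ adj G u v by apply/negP => /bG [h _]; rewrite leqNgt h in hu.
by rewrite ?orFb ?andbT; case: (v == x).
Qed.

Definition conn (e : rel nat) u v := exists2 p, path e u p & last u p = v.

Lemma conn_trans e : forall u v w, conn e u v -> conn e v w -> conn e u w.
Proof.
move=> u v w [p pp <-] [q qq <-]; exists (p ++ q); last by rewrite last_cat.
by rewrite cat_path pp.
Qed.

Lemma conn_sym e u v : symmetric e -> conn e u v -> conn e v u.
Proof.
move=> se [p pp <-]; exists (rev (belast u p)).
  by rewrite rev_path; apply: sub_path pp => a b; rewrite se.
by case: p pp => //= a p _; rewrite rev_cons last_rcons.
Qed.

Lemma conn1 (e : rel nat) u v : e u v -> conn e u v.
Proof. by move=> h; exists [:: v] => //=; rewrite h. Qed.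

(** The set [W] is the side of [u] in the cut left by deleting the edge. In this form a bridge is
    easily carried through [attach], and a walk that has left [W] can re-enter it only along the
    same edge. *)
Definition bridge G u v := exists W : pred nat,
  [/\ W u, ~~ W v & forall a b, adj G a b -> W a -> ~~ W b -> a = u /\ b = v].

Definition bridged_tree (r : nat) (G : graph) : Prop :=
  [/\ is_graph G, connected_graph G,
      (r < nverts G)%N, forall u, adj G u u = (u == r)
    & forall u v, adj G u v -> u != v -> bridge G u v].

(** For the cut take the vertices still connected to [u] once the edge is deleted. If [v] were among
    them, a simple path from [u] to [v] closed by the edge would be a cycle with at least three
    vertices. *)
Lemma rooted_tree_bridged G : is_rooted_tree G -> exists r, bridged_tree r G.
Proof.
move=> [gG cG aG [r hr lr]]; exists r; split=> // u v auv nuv.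
pose e := [rel a b | [&& adj G a b, (a, b) != (u, v) & (a, b) != (v, u)]].
have he : subrel e (adj G) by move=> a b /= /andP[].
exists (fun a => `[< conn e u a >]).
have nW : ~ conn e u v.
  move=> [p pp lp]; case/shortenP: pp lp => p' pp' up' _ lp.
  have [_ sG] := gG.
  have /aG : ucycle (adj G) (u :: p').
    by apply/andP; split=> //; rewrite /= rcons_path lp (sub_path he pp') /= sG.
  case: p' pp' lp {up'} => [_ /= euv|w [|? ?]] //; first by rewrite euv eqxx in nuv.
  by move=> /= + ew; rewrite ew eqxx /= andbF.
split; [by apply/asboolP; exists [::]|by apply/asboolPn|].
move=> a b aab /asboolP wa /asboolPn wb.
have : ~~ e a b by apply/negP => eab; apply: wb; apply: (conn_trans wa); apply: conn1.
rewrite /= aab /= negb_and !negbK => /orP[] /eqP[ea eb]; first by [].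
by case: nW; rewrite -ea.
Qed.

Lemma attach_graph G x k : is_graph G -> (x < nverts G)%N -> is_graph (attach G x k).
Proof.
move=> [bG sG] hx; split=> [u v|u v].
  rewrite adj_attach /= => /or3P[/bG[hu hv]|/andP[/eqP -> /andP[_ hv]]|/andP[/eqP -> /andP[_ hu]]].
  - by split; apply: ltn_addr.
  - by split=> //; apply: ltn_addr.
  - by split=> //; apply: ltn_addr.
by rewrite !adj_attach sG; congr (_ || _); rewrite orbC.
Qed.

Lemma adj_attachW G x k u v : adj G u v -> adj (attach G x k) u v.
Proof. by rewrite adj_attach => ->. Qed.

(** An old cut extends by putting every new leaf on the side of [x]; a new edge is cut by separating
    its leaf from all other vertices. *)
Lemma attach_bridged r G x k :
  bridged_tree r G -> (x < nverts G)%N -> bridged_tree r (attach G x k).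
Proof.
move=> [gG cG hr lr cutG] hx; have gG' := attach_graph k gG hx.
have [bG sG] := gG; have [_ sG'] := gG'.
split=> //.
- have cx u : (u < nverts (attach G x k))%N -> conn (adj (attach G x k)) u x.
    rewrite /= => hu; have [huN|huN] := ltnP u (nverts G).
      have [p pp <-] := cG _ _ huN hx; exists p => //.
      by apply: sub_path pp => a b; apply: adj_attachW.
    by apply: conn1; rewrite adj_attach eqxx huN hu !orbT.
  move=> u v /cx hu /cx hv; apply: (conn_trans hu); exact: conn_sym.
- by rewrite /= ltn_addr.
- move=> u; rewrite adj_attach lr; case: eqVneq => //= _.
  by case: eqVneq => //= ->; rewrite leqNgt hx.
- move=> u v; rewrite adj_attach => /or3P[auv|/andP[/eqP -> hv]|/andP[/eqP -> hu]] nuv.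
  + have [W [Wu Wv cW]] := cutG _ _ auv nuv; have [hu hv] := bG _ _ auv.
    exists (fun a => if (a < nverts G)%N then W a else W x); rewrite hu hv; split=> // a b.
    rewrite adj_attach => /or3P[aab|/andP[/eqP -> /andP[hb _]]|/andP[/eqP -> /andP[ha _]]].
    * by have [-> ->] := bG _ _ aab; apply: cW.
    * by rewrite hx ltnNge hb /= => ->.
    * by rewrite hx ltnNge ha /= => ->.
  + exists (fun a => a != v); rewrite eqxx; split=> //.
    move=> a b; rewrite adj_attach => aab na /negbNE /eqP eb; split=> //.
    move: aab; rewrite eb => /or3P[/bG [_]|/andP[/eqP -> //]|/andP[/eqP evx _]].
      by rewrite ltnNge; case/andP: hv => ->.
    by move: hv; rewrite evx leqNgt hx.
  + exists (fun a => a == u); rewrite eqxx; split=> //.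
      by rewrite ltn_eqF // (leq_trans hx) //; case/andP: hu.
    move=> a b; rewrite adj_attach => aab /eqP ea nb; split=> //.
    move: aab; rewrite ea => /or3P[/bG []|/andP[/eqP eux _]|/andP[/eqP -> //]].
      by rewrite ltnNge; case/andP: hu => ->.
    by move: hu; rewrite eux leqNgt hx.
Qed.

(* Each edge, oriented as [(a, b)] with [a < b], carries a cut [W]; the colour
   of [v] is the parity of the number of these cuts containing [v]. *)
Lemma bridged_coloring r G : bridged_tree r G ->
  exists col : nat -> bool, forall u v, adj G u v -> u != v -> col u != col v.
Proof.
move=> [[bG sG] cG hr lr cutG].
have /choice [W hW] : forall e : nat * nat, exists W : pred nat,
    adj G e.1 e.2 -> e.1 != e.2 -> [/\ W e.1, ~~ W e.2 &
      forall a b, adj G a b -> W a -> ~~ W b -> a = e.1 /\ b = e.2].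
  move=> [u v] /=; have [/andP[auv nuv]|h] := boolP (adj G u v && (u != v)).
    by have [W hW] := cutG _ _ auv nuv; exists W.
  by exists pred0 => auv nuv; rewrite auv nuv in h.
exists (fun v => \big[addb/false]_(e <- enum_fset (edges G) | (e.1 < e.2)%N) W e v).
suff H u v : adj G u v -> (u < v)%N ->
    \big[addb/false]_(e <- enum_fset (edges G) | (e.1 < e.2)%N) W e u !=
    \big[addb/false]_(e <- enum_fset (edges G) | (e.1 < e.2)%N) W e v.
  move=> u v auv; rewrite neq_ltn => /orP[|vu]; first exact: H.
  by rewrite eq_sym; apply: H => //; rewrite sG.
move=> auv uv; rewrite negb_eqb -big_split big_mkcond /= (bigD1_seq (u, v)) ?fset_uniq //=.
have nuv : u != v by rewrite ltn_eqF.
have [Wu Wv _] := hW (u, v) auv nuv; rewrite uv Wu (negbTE Wv) /=.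
rewrite big_seq_cond big1 // => -[a b] /andP[hab nab] /=; case: ifP => // ab.
have [|_ _ cW] := hW (a, b) hab; first by rewrite /= ltn_eqF.
case: (boolP (W (a, b) u)) (boolP (W (a, b) v)) => Wau [Wav|Wav] //=.
  by have [/= ea eb] := cW _ _ auv Wau Wav; rewrite ea eb eqxx in nab.
have [|/= ea eb] := cW v u _ Wav Wau; first by rewrite sG.
by rewrite -ea -eb ltnNge ltnW in ab.
Qed.

(** * Growing trees along a walk *)

Definition walk s T0 (k x : nat -> nat) n :=
  forall i, (i < n)%N -> x i.+1 \in nbrs (tree_at s T0 k x i.+1) (x i).

Lemma nverts_tree_mono s T0 k x m n : (m <= n)%N ->
  (nverts (tree_at s T0 k x m) <= nverts (tree_at s T0 k x n))%N.
Proof.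
elim: n => [|n IH]; first by rewrite leqn0 => /eqP ->.
rewrite leq_eqVlt => /predU1P[-> //|/IH hm]; apply: leq_trans hm _ => /=.
by case: ifP => //= _; rewrite leq_addr.
Qed.

Lemma adj_tree_mono s T0 k x m n u v : (m <= n)%N ->
  adj (tree_at s T0 k x m) u v -> adj (tree_at s T0 k x n) u v.
Proof.
move=> + a; elim: n => [|n IH]; first by rewrite leqn0 => /eqP <-.
rewrite leq_eqVlt => /predU1P[<- //|/IH hm] /=.
by case: ifP => //= _; apply: adj_attachW.
Qed.

(** Vertices are added only at multiples of [s]. The term [k 0] stands apart because [env_sum]
    starts at index 1. *)
Lemma nverts_tree_at s T0 k x n : (0 < s)%N ->
  nverts (tree_at s T0 k x (s * n).+1) =
  (nverts T0 + k 0 + \sum_(1 <= j < n.+1) k (s * j))%N.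
Proof.
move=> s0.
have H m : nverts (tree_at s T0 k x m) = (nverts T0 + \sum_(0 <= i < m | (s %| i)%N) k i)%N.
  elim: m => [|m IH]; first by rewrite big_geq // addn0.
  rewrite big_mkcond big_nat_recr //= -big_mkcond /=.
  by case: ifP => _ /=; rewrite IH ?addnA // addn0.
rewrite H -addnA; congr addn; elim: n => [|n IH].
  by rewrite muln0 big_mkcond big_nat1 dvdn0 big_geq // addn0.
rewrite (@big_cat_nat _ _ _ (s * n).+1) //=; last by rewrite ltnS leq_mul.
rewrite IH -addnA [in RHS]big_nat_recr //=; congr (_ + (_ + _))%N.
rewrite big_mkcond big_nat_recr /=; last by rewrite ltn_mul2l s0 /=.
rewrite dvdn_mulr // big_nat_cond big1 ?add0n // => i /andP[/andP[hi hi'] _].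
case: ifP => // /dvdnP[q eq]; move: hi hi'; rewrite eq [(q * s)%N]mulnC !ltn_mul2l s0 /=.
by rewrite ltnS => h1 h2; move: (leq_trans h1 h2); rewrite ltnn.
Qed.

Section WalkTree.
Variables (s : nat) (T0 : graph) (k x : nat -> nat) (r : nat).
Hypotheses (hT0 : bridged_tree r T0) (hx0 : (x 0 < nverts T0)%N).

Let T := tree_at s T0 k x.

Lemma walk_treeP n : walk s T0 k x n -> forall m, (m <= n)%N ->
  bridged_tree r (T m) /\ (x m < nverts (T m))%N.
Proof.
move=> hw; elim=> [|m IH] hm; first by split.
have [bT hx] := IH (ltnW hm); have := hw _ hm; rewrite mem_nbrs -/(T m.+1) => /andP[hx' _].
split=> //; rewrite /T /= -/(T m); case: ifP => // _; exact: attach_bridged.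
Qed.

Lemma walk_tree_next n : walk s T0 k x n -> bridged_tree r (T n.+1).
Proof.
move=> hw; have [bT hx] := walk_treeP hw (leqnn n); rewrite /T /= -/(T n).
by case: ifP => // _; exact: attach_bridged.
Qed.

End WalkTree.

(** * Propagation of edge crossings through the tree *)

Definition crosses (x : nat -> nat) u v :=
  forall n, exists m, [/\ (n <= m)%N, x m = u & x m.+1 = v].

Section Recurrence.
Variables (s : nat) (T0 : graph) (k x : nat -> nat) (r : nat).
Hypotheses (hT0 : bridged_tree r T0) (hx0 : (x 0 < nverts T0)%N).
Let T := tree_at s T0 k x.
Hypothesis hw : forall n, walk s T0 k x n.

Lemma tree_bridged n : bridged_tree r (T n).
Proof. by have [] := walk_treeP hT0 hx0 (@hw n) (leqnn n). Qed.

Lemma step_adj i n : (i < n)%N -> adj (T n) (x i) (x i.+1).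
Proof.
move=> hi; apply: (adj_tree_mono hi).
by have := @hw n i hi; rewrite mem_nbrs => /andP[].
Qed.

(* The edge [uv] being a bridge of every [T n], between two crossings from [u]
   to [v] there is a crossing from [v] to [u]. *)
Lemma crosses_rev u v : crosses x u v -> crosses x v u.
Proof.
move=> huv; have [evu|nuv] := eqVneq v u; first by rewrite evu in huv *.
move=> n.
have [m1 [hm1 xm1 xm1']] := huv n.
have [m2 [hm2 xm2 xm2']] := huv m1.+1.
have [_ _ _ _ /(_ u v)] := tree_bridged m2.+1.
case; [by rewrite -xm1 -xm1'; apply: step_adj; rewrite ltnS ltnW|by rewrite eq_sym|].
move=> W [Wu Wv cW].
have [j [hj1 hj2 Wj Wj']] : exists j, [/\ (m1.+1 <= j)%N, (j < m2)%N, ~~ W (x j) & W (x j.+1)].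
  have : W (x m2) by rewrite xm2.
  have := hm2; elim: m2 {hm2 xm2 xm2' cW} => [//|j IH].
  rewrite leq_eqVlt => /predU1P[<-|hj]; first by rewrite xm1' (negbTE Wv).
  move=> Wj; have [Wj'|Wj'] := boolP (W (x j)); last by exists j.
  by have [i [? ? ? ?]] := IH hj Wj'; exists i; split=> //; rewrite ltnW.
exists j; have [_ sG] : is_graph (T m2.+1) by have [] := tree_bridged m2.+1.
have [] := cW (x j.+1) (x j) _ Wj' Wj; last by split=> //; apply: leq_trans (ltnW hj1).
by rewrite sG; apply: step_adj; rewrite ltnW.
Qed.

Hypothesis spread : forall n u v v',
  crosses x u v -> adj (T n) u v' -> crosses x u v'.

(** At each vertex of the path, crossings spread to the edge leading on; reversing them gives
    crossings out of the next vertex. *)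
Lemma crosses_path n u v p : crosses x u v -> path (adj (T n)) u p ->
  exists w, crosses x (last u p) w.
Proof.
elim: p u v => [|a p IH] u v huv /=; first by exists v.
move=> /andP[ua]; apply: IH; apply: crosses_rev; exact: spread huv ua.
Qed.

Lemma crosses_all n u v z w : crosses x u v -> (u < nverts (T n))%N ->
  adj (T n) z w -> crosses x z w.
Proof.
move=> huv hu zw; have [[bG _] cG _ _ _] := tree_bridged n.
have [hz _] := bG _ _ zw; have [p pp lp] := cG _ _ hu hz.
by have [y] := crosses_path huv pp; rewrite lp => zy; exact: spread zy zw.
Qed.

End Recurrence.

(** * Recurrence along a fixed trajectory *)

Definition unbounded_sum (R : realType) (n : nat) (c : nat -> R) :=
  forall K : R, exists N, K <= \sum_(n <= m < N) c m.

Lemma unbounded_sum_tail (R : realType) (c : nat -> R) m n : (m <= n)%N ->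
  unbounded_sum m c -> unbounded_sum n c.
Proof.
move=> mn uc K; have [N hN] := uc (K + \sum_(m <= i < n) `|c i|).
exists N; have [nN|Nn] := leqP n N.
  rewrite (big_cat_nat mn nN) /= [leRHS]addrC in hN.
  have : \sum_(m <= i < n) c i <= \sum_(m <= i < n) `|c i|.
    by apply: ler_sum => i _; exact: ler_norm.
  by move: hN; lra.
rewrite big_geq ?(ltnW Nn) //.
have [mN|Nm] := leqP m N; last first.
  have e : \sum_(m <= i < N) c i = 0 by rewrite big_geq // ltnW.
  by move: hN; rewrite e; apply: le_trans; rewrite lerDl sumr_ge0.
have : \sum_(m <= i < N) c i <= \sum_(m <= i < n) `|c i|.
  rewrite (big_cat_nat mN (ltnW Nn)) /= ler_wpDr ?sumr_ge0 //.
  by apply: ler_sum => i _; exact: ler_norm.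
by move: hN; lra.
Qed.

Section Clocks.
Variables (R : realType) (s : nat) (T0 : graph).
Implicit Types k x : nat -> nat.

(* Conditional probability of a step from [u] to [v] at time [m]. *)
Definition cross_rate k x u v m : R :=
  ((x m == u) && (v \in nbrs (tree_at s T0 k x m.+1) u))%:R
    / (degree (tree_at s T0 k x m.+1) u)%:R.

(** Marks a step from [u] to [v'] at a time when [v] was available too. Neighbours being equally
    likely, such steps can serve as a clock for the crossings from [u] to [v]. *)
Definition cross_ind k x u v' v m : R :=
  [&& x m == u, v \in nbrs (tree_at s T0 k x m.+1) u & x m.+1 == v']%:R.

Lemma cross_rate_ge0 k x u v m : 0 <= cross_rate k x u v m.
Proof. by rewrite mulr_ge0 ?invr_ge0. Qed.

End Clocks.

(** * Crossings and visits on a typical trajectory *)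

Section DetRecurrence.
Variables (R : realType) (s : nat) (T0 : graph) (k x : nat -> nat) (r : nat).
Hypotheses (hT0 : bridged_tree r T0) (hx0 : (x 0 < nverts T0)%N).
Let T := tree_at s T0 k x.
Hypothesis hw : forall n, walk s T0 k x n.
Hypotheses (s0 : (0 < s)%N) (s_even : ~~ odd s).
Hypothesis rate_cross : forall n u v,
  unbounded_sum n (@cross_rate R s T0 k x u v) ->
  exists m, [/\ (n <= m)%N, x m = u & x m.+1 = v].
Hypothesis ind_cross : forall n u v' v,
  unbounded_sum n (@cross_ind R s T0 k x u v' v) ->
  exists m, [/\ (n <= m)%N, x m = u & x m.+1 = v].
Hypothesis env_slow : forall C : nat, (0 < C)%N ->
  unbounded_sum 0 (fun j => ((C + \sum_(1 <= i < j.+1) k (s * i))%N%:R)^-1 : R).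

Lemma adj_next n m u v : (n <= m)%N -> adj (T n) u v -> v \in nbrs (T m.+1) u.
Proof.
move=> nm uv; have [gG _ _ _ _] := tree_bridged hT0 hx0 hw m.+1.
by rewrite nbrs_adj //; apply: adj_tree_mono uv; apply: leqW.
Qed.

(** Once [v'] is a neighbour of [u] it stays one, so each later crossing from [u] to [v] adds one to
    the clock [cross_ind] of [v']. The clock diverges and [ind_cross] applies. *)
Lemma crosses_spread n u v v' : crosses x u v -> adj (T n) u v' -> crosses x u v'.
Proof.
move=> huv uv' n0; pose N0 := maxn n n0.
have [|m [hm xm xm']] := @ind_cross N0 u v v'.
  move=> K; suff [N [hN KN]] : exists N, (N0 <= N)%N /\
      (Num.bound `|K|)%:R <= \sum_(N0 <= m < N) cross_ind R s T0 k x u v v' m.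
    by exists N; apply: le_trans KN; apply: le_trans (ler_norm _) (ltW (archi_boundP (normr_ge0 _))).
  elim: (Num.bound `|K|) => [|j [N [hN KN]]]; first by exists N0; rewrite big_geq.
  have [m [hm xm xm']] := huv N; exists m.+1; split; first exact: leq_trans (leqW hm).
  rewrite big_nat_recr ?(leq_trans hN) //= -natr1 lerD //.
    apply: le_trans KN _; rewrite (@big_cat_nat _ _ _ N _ m) //= lerDl.
    by rewrite sumr_ge0.
  rewrite /cross_ind xm xm' !eqxx andbT (@adj_next n) //.
  by apply: leq_trans hm; apply: leq_trans hN; rewrite leq_maxl.
by exists m; split=> //; apply: leq_trans hm; rewrite leq_maxr.
Qed.

(** Edges are never removed, so from time [n] on the quantity summed is the rate of the edge from
    [u] to [v] itself. *)
Lemma unbounded_rate_crosses n u v :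
  unbounded_sum n (fun m => (x m == u)%:R / (degree (T m.+1) u)%:R : R) ->
  adj (T n) u v -> crosses x u v.
Proof.
move=> uc uv n0; pose N0 := maxn n n0.
have hN0 : (n <= N0)%N by rewrite leq_maxl.
have [|m [hm xm xm']] := @rate_cross N0 u v.
  move=> K; have [N hN] := unbounded_sum_tail hN0 uc K; exists N.
  apply: le_trans hN _; rewrite le_eqVlt; apply/orP; left; apply/eqP.
  rewrite big_nat_cond [RHS]big_nat_cond; apply: eq_bigr => m /andP[/andP[hm _] _].
  by rewrite /cross_rate (@adj_next n) ?andbT // (leq_trans hN0).
by exists m; split=> //; apply: leq_trans hm; rewrite leq_maxr.
Qed.

Lemma bridged_neighbor G u : bridged_tree r G -> (u < nverts G)%N -> exists v, adj G u v.
Proof.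
move=> [_ cG hr lr _] hu; have [[|v p] /= pp lp] := cG _ _ hu hr.
  by exists r; rewrite lp lr.
by exists v; case/andP: pp.
Qed.

(* As long as the loop is not used, the colour of the walker alternates, so at
   the (even) growth times it always has the same colour and only leaves of the
   other colour are created. *)
Lemma no_loop_confined n j : (forall m, (s * n <= m)%N -> ~ (x m = r /\ x m.+1 = r)) ->
  (n <= j)%N -> (x (s * j) < nverts (T (s * n)))%N.
Proof.
move=> noloop nj; set M := (s * j)%N; set m0 := (s * n)%N.
have hM : (m0 <= M)%N by rewrite leq_mul.
have bT m := tree_bridged hT0 hx0 hw m.
(* The tree [T M] contains all earlier edges, so one colouring serves every time up to [M]. *)
have [col hcol] := bridged_coloring (bT M).
have [_ _ _ lr _] := bT M.
have alt i : (m0 <= i <= M)%N -> col (x i) = col (x m0) (+) odd (i - m0).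
  move=> /andP[]; elim: i => [|i IH].
    by rewrite leqn0 => /eqP -> _; rewrite subnn addbF.
  rewrite leq_eqVlt => /predU1P[<-|hi hi']; first by rewrite subnn addbF.
  have a := step_adj hw hi'.
  have /(hcol _ _ a) : x i != x i.+1.
    apply/eqP => e; move: a; rewrite -e -/(T M) lr => /eqP er.
    by apply: (noloop i) => //; rewrite -e.
  rewrite (IH hi (ltnW hi')) subSn // oddS.
  by case: (col (x i.+1)) (col (x m0)) (odd _) => [] [] [].
have new i v : (m0 <= i <= M)%N -> (v < nverts (T i))%N ->
    (v < nverts (T m0))%N || (col v != col (x m0)).
  move=> /andP[]; elim: i => [|i IH]; first by rewrite leqn0 => /eqP -> _ ->.
  rewrite leq_eqVlt => /predU1P[<- _ ->//|hi hi'].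
  have [hv _|hv] := ltnP v (nverts (T i)); first exact: IH hi (ltnW hi') hv.
  rewrite /T /= -/(T i); case: ifP => [si hv'|_]; last by rewrite ltnNge hv.
  apply/orP; right.
  have a : adj (T i.+1) v (x i).
    by rewrite /T /= si -/(T i) adj_attach eqxx hv hv' !orbT.
  have {}a := adj_tree_mono hi' a.
  have hxi : (x i < nverts (T i))%N by case: (walk_treeP hT0 hx0 (@hw i) (leqnn i)).
  have /(hcol _ _ a) : v != x i by rewrite gtn_eqF // (leq_trans hxi).
  have oi : odd (i - m0) = false.
    rewrite oddB // oddM (negbTE s_even) addbF.
    by move: si => /dvdnP[q ->]; rewrite oddM (negbTE s_even) andbF.
  have hi2 : (m0 <= i <= M)%N by apply/andP; split; [exact: hi|exact: ltnW].
  by rewrite (alt _ hi2) oi addbF.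
have hxM : (x M < nverts (T M))%N by case: (walk_treeP hT0 hx0 (@hw M) (leqnn M)).
have := new M (x M); rewrite hM leqnn hxM => /(_ isT isT) /orP[//|].
have oM : odd (M - m0) = false by rewrite oddB // !oddM (negbTE s_even).
have hM2 : (m0 <= M <= M)%N by rewrite hM leqnn.
by rewrite (alt _ hM2) oM addbF eqxx.
Qed.

Lemma loop_crosses : crosses x r r.
Proof.
apply: contrapT => nl.
have [n0 noloop] : exists n, forall m, (n <= m)%N -> ~ (x m = r /\ x m.+1 = r).
  apply: contrapT => h; apply: nl => n; apply: contrapT => h'; apply: h.
  by exists n => m nm [e1 e2]; apply: h'; exists m.
have hsn : (n0 <= s * n0)%N by rewrite leq_pmull.
have conf j : (n0 <= j)%N -> (x (s * j) < nverts (T (s * n0)))%N.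
  by apply: no_loop_confined => m /(leq_trans hsn); exact: noloop.
set N := nverts (T (s * n0)) in conf.
(* Passes from growth times to all times by adding nonnegative terms. *)
have sum_mul (f : nat -> R) J : (forall m, 0 <= f m) ->
    \sum_(n0 <= j < J) f (s * j)%N <= \sum_(s * n0 <= m < s * J) f m.
  move=> f0; have [n0J|/ltnW Jn0] := leqP n0 J; last first.
    by rewrite big_geq // sumr_ge0.
  rewrite -(subnKC n0J); elim: (J - n0)%N => [|i IH].
    by rewrite addn0 !big_geq.
  rewrite addnS big_nat_recr ?leq_addr //=.
  rewrite [leRHS](@big_cat_nat _ _ _ (s * (n0 + i))) /= ?leq_mul ?leq_addr //.
  rewrite lerD // big_ltn ?ltn_mul2l ?s0 ?leqnn //= lerDl.
  by rewrite sumr_ge0.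
pose f u m : R := (x m == u)%:R / (degree (T m.+1) u)%:R.
have f0 u m : 0 <= f u m by rewrite mulr_ge0 ?invr_ge0.
(* Pigeonhole over the finitely many vertices of [T (s * n0)]: were all their rates summable, the
   sum over growth times would be bounded, although at each of them the vertex of the walker
   contributes the inverse of its degree. *)
have [u [uN uu]] : exists u, (u < N)%N /\ unbounded_sum (s * n0) (f u).
  apply: contrapT => h.
  have /choice[B hB] : forall u, exists B, (u < N)%N ->
      forall J, \sum_(s * n0 <= m < J) f u m <= B.
    move=> u; apply: contrapT => h1; apply: h; exists u; split.
      by apply: contrapT => uN; apply: h1; exists 0.
    move=> K; apply: contrapT => h2; apply: h1; exists K => _ J.
    by rewrite leNgt; apply/negP => h3; apply: h2; exists J; rewrite ltW.
  (* The constant is [nverts T0 + k 0]: with it the denominators are the vertex numbers of the trees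
     at times [(s * j).+1], which bound the degrees. *)
  have hslow := unbounded_sum_tail (leq0n n0) (env_slow (ltn_addr (k 0) (leq_ltn_trans (leq0n _) hx0))).
  have [J hJ] := hslow (\sum_(u < N) B u + 1).
  suff : \sum_(u < N) B u + 1 <= \sum_(u < N) B u by rewrite gerDl ler10.
  apply: le_trans hJ _.
  have : \sum_(u < N) \sum_(s * n0 <= m < s * J) f u m <= \sum_(u < N) B u.
    by apply: ler_sum => u _; apply: hB.
  apply: le_trans.
  have : \sum_(u < N) \sum_(n0 <= j < J) f u (s * j)%N <=
      \sum_(u < N) \sum_(s * n0 <= m < s * J) f u m.
    by apply: ler_sum => u _; apply: sum_mul.
  apply: le_trans; rewrite exchange_big /=.
  rewrite big_nat_cond [leRHS]big_nat_cond; apply: ler_sum => j /andP[/andP[hj _] _].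
  rewrite (bigD1 (Ordinal (conf _ hj))) //= [f _ _]/f eqxx mul1r.
  apply: (@le_trans _ _ (degree (T (s * j).+1) (x (s * j)))%:R^-1); last first.
    by rewrite lerDl sumr_ge0.
  rewrite -(nverts_tree_at T0 k x j s0) -/T.
  have dpos : (0 < degree (T (s * j).+1) (x (s * j)))%N.
    have := @hw (s * j).+1 _ (leqnn _); rewrite /degree -/T.
    by case: (nbrs _ _).
  have dle := degree_le_nverts (T (s * j).+1) (x (s * j)).
  by rewrite lef_pV2 ?ler_nat // posrE ltr0n // (leq_trans dpos).
have bT := tree_bridged hT0 hx0 hw (s * n0).
have [v uv] := bridged_neighbor bT uN.
have cuv := unbounded_rate_crosses uu uv.
apply: nl; apply: (crosses_all hT0 hx0 hw crosses_spread cuv uN).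
by have [_ _ _ -> _] := bT.
Qed.

Lemma visits_io n z m : (z < nverts (T n))%N -> exists m', (m <= m')%N /\ x m' = z.
Proof.
have bT := tree_bridged hT0 hx0 hw n; move=> /(bridged_neighbor bT)[w zw].
have [_ _ hr _ _] := bT.
have [m' [hm xm _]] := crosses_all hT0 hx0 hw crosses_spread loop_crosses hr zw m.
by exists m'.
Qed.

End DetRecurrence.

(** * Functions of finitely many steps *)

(** Measurability with respect to the finite past, stated on trajectories: only the first [a]
    environment values and the first [b] positions matter. *)
Definition adapted (T : Type) a b (f : (nat -> nat) -> (nat -> nat) -> T) :=
  forall k k' x x', (forall i, (i < a)%N -> k i = k' i) ->
    (forall i, (i < b)%N -> x i = x' i) -> f k x = f k' x'.

Definition update (x : nat -> nat) n y : nat -> nat := fun i => if i == n then y else x i.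

(** The conditional expectation of [f] given the environment and the positions up to time [m], as an
    explicit average over the next step. *)
Definition step_mean (R : realType) s T0 m (f : (nat -> nat) -> (nat -> nat) -> R) k x : R :=
  (\sum_(y <- nbrs (tree_at s T0 k x m.+1) (x m)) f k (update x m.+1 y))
    / (degree (tree_at s T0 k x m.+1) (x m))%:R.

Lemma adaptedW T a a' b b' (f : _ -> _ -> T) : (a <= a')%N -> (b <= b')%N ->
  adapted a b f -> adapted a' b' f.
Proof.
move=> aa bb hf k k' x x' hk hx; apply: hf => i hi; [apply: hk|apply: hx].
  exact: leq_trans aa.
exact: leq_trans bb.
Qed.

Lemma adapted_tree s T0 n : adapted n n (fun k x => tree_at s T0 k x n).
Proof.
elim: n => [//|n IH] k k' x x' hk hx /=.
by rewrite (IH k k' x x') ?hk ?hx // => i hi; [apply: hk|apply: hx]; apply: leqW.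
Qed.

Lemma adapted_step_mean (R : realType) s T0 a m (f : _ -> _ -> R) : (m < a)%N ->
  adapted a m.+2 f -> adapted a m.+1 (step_mean s T0 m f).
Proof.
move=> ma hf k k' x x' hk hx; rewrite /step_mean.
have -> : tree_at s T0 k x m.+1 = tree_at s T0 k' x' m.+1.
  by apply: adapted_tree => // i hi; apply: hk; exact: leq_trans hi ma.
rewrite hx //; congr (_ / _); apply: eq_bigr => y _; apply: hf => // i hi.
by rewrite /update; case: eqVneq => // ni; apply: hx; rewrite ltn_neqAle ni.
Qed.

(** * Finite pasts as atoms of countable partitions *)

Section Fibers.
Context (R : realType) (d : measure_display) (Omega : measurableType d).
Context (P : probability Omega R).
Variables (xi X : nat -> {RV P >-> nat}).

Definition fiber a b (k x : nat -> nat) : set Omega :=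
  [set w | (forall i, (i < a)%N -> xi i w = k i) /\ (forall i, (i < b)%N -> X i w = x i)].

Local Notation path f w := (f (fun i => xi i w) (fun i => X i w)).

Lemma measurable_RV_preimage (Y : {RV P >-> nat}) (A : set nat) : measurable (Y @^-1` A).
Proof. by rewrite -[X in measurable X]setTI; exact: measurable_funP. Qed.

Lemma measurable_fiber a b k x : measurable (fiber a b k x).
Proof.
have -> : fiber a b k x = (\bigcap_(i in [set i | (i < a)%N]) (xi i @^-1` [set k i])) `&`
    (\bigcap_(i in [set i | (i < b)%N]) (X i @^-1` [set x i])).
  by apply/seteqP; split=> w.
by apply: measurableI; apply: fin_bigcap_measurable => [|i _]; do ?[exact: measurable_RV_preimage];
  exact: finite_II.
Qed.

(** Numbers the possible finite pasts, so that the fibers form a partition indexed by the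
    integers. *)
Definition code a b w : nat :=
  choice.pickle ([seq xi i w | i <- iota 0 a], [seq X i w | i <- iota 0 b]).

Lemma code_fiber a b w : code a b @^-1` [set code a b w] =
  fiber a b (fun i => xi i w) (fun i => X i w).
Proof.
apply/seteqP; split=> v /=.
  move=> /(pcan_inj (@choice.pickleK _)) [/eq_in_map h1 /eq_in_map h2].
  by split=> i hi; [apply: h1|apply: h2]; rewrite mem_iota.
move=> [h1 h2]; rewrite /code; congr (choice.pickle (_, _)).
  by apply/eq_in_map => i; rewrite mem_iota => hi; exact: h1.
by apply/eq_in_map => i; rewrite mem_iota => hi; exact: h2.
Qed.

Lemma measurable_code a b i : measurable (code a b @^-1` [set i]).
Proof.
have [->|/set0P[w /= <-]] := eqVneq (code a b @^-1` [set i]) set0; first exact: measurable0.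
by rewrite code_fiber; exact: measurable_fiber.
Qed.

Lemma measurable_adapted_set a b (A : (nat -> nat) -> (nat -> nat) -> Prop) :
  adapted a b A -> measurable [set w | path A w].
Proof.
move=> hA.
have -> : [set w | path A w] = \bigcup_(i in code a b @` [set w | path A w]) (code a b @^-1` [set i]).
  apply/seteqP; split=> w /=; first by move=> Aw; exists (code a b w) => //; exists w.
  move=> [_ [w' Aw' <-]]; rewrite code_fiber => -[h1 h2].
  by rewrite (hA _ (fun i => xi i w') _ (fun i => X i w')).
by apply: bigcup_measurable => i _; exact: measurable_code.
Qed.

Lemma measurable_adapted a b d' (T : measurableType d') (f : (nat -> nat) -> (nat -> nat) -> T) :
  adapted a b f -> measurable_fun setT (fun w => path f w).
Proof.
move=> hf _ Y mY; rewrite setTI.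
apply: (@measurable_adapted_set a b (fun k x => Y (f k x))) => k k' x x' hk hx.
by rewrite (hf _ _ _ _ hk hx).
Qed.

Lemma integral_fibers a b (F : Omega -> \bar R) :
  measurable_fun setT F -> (forall w, 0 <= F w)%E ->
  (\int[P]_w F w = \sum_(i <oo) \int[P]_(w in code a b @^-1` [set i]) F w)%E.
Proof.
move=> mF F0; rewrite -ge0_integral_bigcup //.
- by congr (integral _ _ _); apply/seteqP; split=> w //= _; exists (code a b w).
- exact: measurable_code.
- exact: measurable_funS mF.
- by move=> i j _ _ [w [/= <- <-]].
Qed.

(** Comparing integrals atom by atom allows conditional statements to be checked with the past
    frozen. *)
Lemma eq_integral_fibers a b (F G : Omega -> \bar R) :
  measurable_fun setT F -> measurable_fun setT G ->
  (forall w, 0 <= F w)%E -> (forall w, 0 <= G w)%E ->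
  (forall k x, \int[P]_(w in fiber a b k x) F w = \int[P]_(w in fiber a b k x) G w)%E ->
  (\int[P]_w F w = \int[P]_w G w)%E.
Proof.
move=> mF mG F0 G0 FG; rewrite !(integral_fibers a b) //; apply: eq_eseriesr => i _.
have [->|/set0P[w /= <-]] := eqVneq (code a b @^-1` [set i]) set0.
  by rewrite !integral_set0.
by rewrite code_fiber.
Qed.

End Fibers.

(** * The tower property for one step *)

Section Law.
Context (R : realType) (d : measure_display) (Omega : measurableType d).
Context (P : probability Omega R).
Variables (s : nat) (T0 : graph) (x0 : nat) (xi X : nat -> {RV P >-> nat}).
Hypotheses (hindep : mutually_independent xi) (hX : is_TBRW s T0 x0 xi X).

Local Notation path f w := (f (fun i => xi i w) (fun i => X i w)).
Local Notation fiber := (fiber xi X).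

Lemma integral_path_cst a b (f : (nat -> nat) -> (nat -> nat) -> R) k x (A : set Omega) :
  adapted a b f -> measurable A -> A `<=` fiber a b k x ->
  (\int[P]_(w in A) (path f w)%:E = (f k x)%:E * P A)%E.
Proof.
move=> hf mA hA; rewrite -integral_cst //; apply: eq_integral => w /set_mem /hA[h1 h2] /=.
by congr (_%:E); apply: hf.
Qed.

Lemma nneseries_finite (f : nat -> R) N : (forall y, 0 <= f y) ->
  (forall y, (N <= y)%N -> f y = 0) ->
  (\sum_(y <oo) (f y)%:E = (\sum_(0 <= y < N) f y)%:E)%E.
Proof.
move=> f0 fN; rewrite (nneseries_split 0 N) => [|y _]; last by rewrite lee_fin.
rewrite eseries0 => [|y Ny _]; last by rewrite fN.
by rewrite adde0 add0n -sumEFin.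
Qed.

Lemma fiber_cylinder m n k x :
  fiber m.+1 n.+1 k x = cylinder xi m k `&` cylinder X n x.
Proof. by apply/seteqP; split=> w. Qed.

Lemma prob_next a m k x y : (m < a)%N ->
  (P (fiber a m.+1 k x `&` X m.+1 @^-1` [set y]) =
   P (fiber a m.+1 k x) * (step_prob R (tree_at s T0 k x m.+1) (x m) y)%:E)%E.
Proof. by case: a => // a ma; rewrite fiber_cylinder -(hX.2 m a k x y) . Qed.

(** Each atom of the past is split according to the value of [X m.+1], whose conditional law is
    [step_prob]. The condition [m < a] makes the tree at time [m.+1] constant on the atom. *)
Lemma integral_path_step a m (f : (nat -> nat) -> (nat -> nat) -> R) : (m < a)%N ->
  adapted a m.+2 f -> (forall k x, 0 <= f k x) ->
  (\int[P]_w (path f w)%:E = \int[P]_w (path (step_mean s T0 m f) w)%:E)%E.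
Proof.
move=> ma hf f0; have hg := adapted_step_mean s T0 ma hf.
have g0 k x : 0 <= step_mean s T0 m f k x.
  by rewrite /step_mean divr_ge0 // sumr_ge0.
have mf : measurable_fun setT (fun w => (path f w)%:E).
  by apply/measurable_EFinP; exact: measurable_adapted hf.
have mg : measurable_fun setT (fun w => (path (step_mean s T0 m f) w)%:E).
  by apply/measurable_EFinP; exact: measurable_adapted hg.
apply: (@eq_integral_fibers _ _ _ _ xi X a m.+1) => // [w|w|k x]; rewrite ?lee_fin //.
have mC := measurable_fiber xi X a m.+1 k x.
rewrite (@integral_path_cst _ _ _ k x _ hg mC) //; set C := fiber _ _ _ _ in mC *.
pose F y := C `&` X m.+1 @^-1` [set y].
have mF y : measurable (F y) by apply: measurableI => //; exact: measurable_RV_preimage.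
have -> : C = \bigcup_y F y.
  by apply/seteqP; split=> [w Cw|w [y _ []//]]; exists (X m.+1 w).
rewrite ge0_integral_bigcup //; last 3 first.
- exact: measurable_funS mf.
- by move=> w _; rewrite lee_fin.
- by move=> i j _ _ [w [[_ /= <-] [_ /= <-]]].
have -> : \bigcup_y F y = C.
  by apply/seteqP; split=> [w [y _ []//]|w Cw]; exists (X m.+1 w).
have [p p0 Pp] : exists2 p : R, 0 <= p & P C = p%:E.
  by exists (fine (P C)); rewrite ?fine_ge0 // fineK // fin_num_measure.
set G := tree_at s T0 k x m.+1.
transitivity (\sum_(y <oo) (f k (update x m.+1 y) * (p * step_prob R G (x m) y))%:E)%E.
  apply: eq_eseriesr => y _; rewrite (@integral_path_cst _ _ _ k (update x m.+1 y) _ hf) //.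
    by rewrite prob_next // -/C Pp.
  move=> w [[h1 h2] /= e]; split=> // i; rewrite ltnS leq_eqVlt /update.
  by case: eqVneq => [-> _|_ /= hi]; [rewrite e|apply: h2].
have st0 y : 0 <= step_prob R G (x m) y by rewrite /step_prob divr_ge0.
rewrite (@nneseries_finite _ (nverts G)); last 2 first.
- by move=> y; rewrite !mulr_ge0.
- by move=> y hy; rewrite /step_prob mem_nbrs ltnNge hy /= mul0r !mulr0.
rewrite Pp -EFinM; congr (_%:E).
rewrite /step_mean -/G {1}/nbrs big_filter [in RHS]big_mkcond /= !big_distrl /=.
rewrite /index_iota subn0 [LHS]big_seq [RHS]big_seq; apply: eq_bigr => y.
rewrite mem_iota add0n => /= hy; rewrite /step_prob mem_nbrs hy /=.
by case: (adj G (x m) y) => /=; rewrite ?mul0r ?mulr0 // mul1r mulrA mulrAC.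
Qed.

End Law.

(** * Product formula for the joint law of environment and positions *)

Definition path_weight (R : realType) s T0 x0 n (k x : nat -> nat) : R :=
  (x 0 == x0)%:R *
  \prod_(i < n) step_prob R (tree_at s T0 k x i.+1) (x i) (x i.+1).

Lemma adapted_path_weight (R : realType) s T0 x0 n :
  adapted n n.+1 (@path_weight R s T0 x0 n).
Proof.
move=> k k' x x' hk hx; rewrite /path_weight hx //; congr (_ * _).
apply: eq_bigr => i _; rewrite !hx ?ltnS ?(ltnW (ltn_ord i)) //.
rewrite (@adapted_tree s T0 i.+1 k k' x x') // => j hj; [apply: hk|apply: hx].
  exact: leq_trans hj _.
by apply: leq_trans hj _; rewrite ltnW // ltnS.
Qed.

Section Law.
Context (R : realType) (d : measure_display) (Omega : measurableType d).
Context (P : probability Omega R).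
Variables (s : nat) (T0 : graph) (x0 : nat) (xi X : nat -> {RV P >-> nat}).
Hypotheses (hindep : mutually_independent xi) (hX : is_TBRW s T0 x0 xi X).

Local Notation path f w := (f (fun i => xi i w) (fun i => X i w)).
Local Notation fiber := (fiber xi X).
Local Notation path_weight := (@path_weight R s T0 x0).

(** Independence is applied twice over the indices up to [m], with [B] and with [setT] at index [m];
    the second use identifies the remaining product. *)
Lemma prob_env_next m k x (B : set nat) :
  (P (fiber m 0 k x `&` xi m @^-1` B) = P (fiber m 0 k x) * P (xi m @^-1` B))%E.
Proof.
pose J := [fset i in iota 0 m.+1]%fset.
have inJ i : (i \in J) = (i < m.+1)%N.
  by rewrite in_fset -[LHS]/(i \in iota 0 m.+1) mem_iota.
have hmJ : m \in J by rewrite inJ.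
pose A (D : set nat) (j : nat) : set nat := if j == m then D else [set k j].
have cap (D : set nat) : \bigcap_(j in [set` J]) (xi j @^-1` A D j) =
    fiber m 0 k x `&` xi m @^-1` D.
  apply/seteqP; split=> w /=.
    move=> h; split; last by have := h m hmJ; rewrite /A eqxx.
    split=> // i hi; have := h i; rewrite /= inJ ltnS (ltnW hi) => /(_ isT).
    by rewrite /A ltn_eqF.
  move=> [[h _] hD] i; rewrite /= inJ ltnS /A.
  by case: eqVneq => [-> //|ni hi]; apply: h; rewrite ltn_neqAle ni.
have rest (D : set nat) : (\prod_(j <- (J `\ m)%fset) P (xi j @^-1` A D j) =
    \prod_(j <- (J `\ m)%fset) P (xi j @^-1` [set k j]))%E.
  by rewrite big_seq [RHS]big_seq; apply: eq_bigr => j; rewrite !inE /A => /andP[/negbTE ->].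
have ind (D : set nat) := hindep J (A D).
have full : P (fiber m 0 k x) = (\prod_(j <- (J `\ m)%fset) P (xi j @^-1` [set k j]))%E.
  have := ind setT; rewrite cap preimage_setT setIT (big_fsetD1 m) //= rest /A eqxx.
  by rewrite preimage_setT probability_setT mul1e.
by have := ind B; rewrite cap (big_fsetD1 m) //= rest -full /A eqxx muleC.
Qed.

(** The law of a step is unaffected by conditioning on later environment values, so the environment
    can be fixed up to [m] once and for all while the positions are revealed one by one. *)
Lemma prob_fiber m n k x : (n <= m)%N ->
  (P (fiber m n.+1 k x) = P (fiber m 0 k x) * (path_weight n k x)%:E)%E.
Proof.
elim: n => [_|n IH]; last first.
  case: m IH => [//|m] IH nm.
  have -> : fiber m.+1 n.+2 k x =
      cylinder xi m k `&` cylinder X n x `&` [set w | X n.+1 w = x n.+1].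
    rewrite -fiber_cylinder; apply/seteqP; split=> w /= [].
      by move=> h1 h2; split; [split=> // i hi; apply: h2; apply: leqW|apply: h2].
    move=> [h1 h2] h3; split=> // i; rewrite ltnS leq_eqVlt => /predU1P[-> //|].
    exact: h2.
  rewrite hX.2 // -fiber_cylinder (IH (ltnW nm)) -muleA -EFinM.
  by rewrite /path_weight big_ord_recr /= mulrA.
rewrite /path_weight big_ord0 mulr1.
have mA : measurable (X 0 @^-1` [set x0]) by exact: measurable_RV_preimage.
have mAc : measurable (X 0 @^-1` (~` [set x0])) by exact: measurable_RV_preimage.
(* The walker starts at [x0] only almost surely, so the other starting points are discarded as a
   null set. *)
have PAc : P (X 0 @^-1` (~` [set x0])) = 0%E.
  by rewrite -preimage_setC probability_setC // (_ : P _ = 1%E) ?subee //; exact: hX.1.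
have mF b : measurable (fiber m b k x) by exact: measurable_fiber.
case: eqVneq => [e0|n0]; rewrite ?mule1 ?mule0.
  rewrite (@measureDI _ _ _ P (fiber m 0 k x) (X 0 @^-1` [set x0])) //.
  rewrite [X in (X + _)%E](@subset_measure0 _ _ _ P _ (X 0 @^-1` (~` [set x0]))) //.
  - rewrite add0e; congr (P _); apply/seteqP; split=> w /=.
      by move=> [h1 h2]; split; [split|rewrite h2].
    by move=> [[h1 h2] h3]; split=> // -[|//] _; rewrite h3.
  - exact: measurableD.
apply: (@subset_measure0 _ _ _ P _ (X 0 @^-1` (~` [set x0]))) => // w [_ h] /= e.
by case/eqP: n0; rewrite -e h.
Qed.

Lemma path_weight_ge0 n k x : 0 <= path_weight n k x.
Proof.
rewrite /path_weight mulr_ge0 // prodr_ge0 // => i _.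
by rewrite /step_prob divr_ge0.
Qed.

(** [xi m] is independent of the past up to and including [X m], because in [prob_fiber] the weight
    of these positions does not involve [k m]. *)
Lemma prob_fiber_env m k x (B : set nat) :
  (P (fiber m m.+1 k x `&` xi m @^-1` B) = P (fiber m m.+1 k x) * P (xi m @^-1` B))%E.
Proof.
have one j : (P (fiber m m.+1 k x `&` xi m @^-1` [set j]) =
    P (fiber m m.+1 k x) * P (xi m @^-1` [set j]))%E.
  have fE b : fiber m b k x `&` xi m @^-1` [set j] = fiber m.+1 b (update k m j) x.
    apply/seteqP; split=> w /=.
      move=> [[h1 h2] h3]; split=> // i; rewrite ltnS leq_eqVlt /update.
      by case: eqVneq => [-> _ //|_ /= hi]; apply: h1.
    move=> [h1 h2]; split; last by rewrite h1 // /update eqxx.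
    by split=> // i hi; rewrite h1 ?(leqW hi) // /update ltn_eqF.
  rewrite fE !prob_fiber // -fE prob_env_next -!muleA; congr (_ * _)%E.
  rewrite muleC; congr ((_)%:E * _)%E; apply: adapted_path_weight => // i hi.
  by rewrite /update ltn_eqF.
have split_j (C : set Omega) : measurable C -> (P (C `&` xi m @^-1` B) =
    \sum_(j <oo | j \in B) P (C `&` xi m @^-1` [set j]))%E.
  move=> mC; rewrite -measure_bigcup; last 2 first.
  - by move=> j _; apply: measurableI => //; exact: measurable_RV_preimage.
  - by move=> i j _ _ [w [[_ /= <-] [_ /= <-]]].
  by congr (P _); apply/seteqP; split=> w /= => [[Cw Bw]|[j Bj [Cw /= ->]]]; first exists (xi m w).
have mC := measurable_fiber xi X m m.+1 k x.
have [p Pp] : exists p : R, P (fiber m m.+1 k x) = p%:E.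
  by exists (fine (P (fiber m m.+1 k x))); rewrite fineK // fin_num_measure.
rewrite split_j // -[xi m @^-1` B]setTI split_j // Pp -nneseriesZl //.
by apply: eq_eseriesr => j _; rewrite setTI one Pp.
Qed.

Lemma integral_path_env m (f : (nat -> nat) -> (nat -> nat) -> R) (B : set nat) :
  adapted m m.+1 f -> (forall k x, 0 <= f k x) ->
  (\int[P]_(w in xi m @^-1` B) (path f w)%:E =
   P (xi m @^-1` B) * \int[P]_w (path f w)%:E)%E.
Proof.
move=> hf f0.
have mf : measurable_fun setT (fun w => (path f w)%:E).
  by apply/measurable_EFinP; exact: measurable_adapted hf.
have mB : measurable (xi m @^-1` B) by exact: measurable_RV_preimage.
have [p p0 Pp] : exists2 p : R, 0 <= p & P (xi m @^-1` B) = p%:E.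
  by exists (fine (P (xi m @^-1` B))); rewrite ?fine_ge0 // fineK // fin_num_measure.
rewrite integral_mkcond Pp -ge0_integralZl_EFin //; last by move=> w _; rewrite lee_fin.
apply: (@eq_integral_fibers _ _ _ _ xi X m m.+1) => //.
- by apply/(measurable_restrictT _ _).1 => //; exact: measurable_funS mf.
- exact: measurable_funeM.
- by move=> w; rewrite patchE; case: ifP => _; rewrite ?lee_fin.
- by move=> w; rewrite -EFinM lee_fin mulr_ge0.
move=> k x; have mC := measurable_fiber xi X m m.+1 k x.
rewrite -integral_mkcondr (@integral_path_cst _ _ _ _ xi X _ _ _ k x _ hf) //; last exact: measurableI.
rewrite prob_fiber_env Pp ge0_integralZl_EFin //; last 2 first.
- by move=> w _; rewrite lee_fin.
- exact: measurable_funS mf.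
by rewrite (@integral_path_cst _ _ _ _ xi X _ _ _ k x _ hf) // muleA muleC.
Qed.

End Law.

(** * Conditional Borel-Cantelli estimates for crossings *)

Lemma step_mean_le (R : realType) s T0 m (f g : (nat -> nat) -> (nat -> nat) -> R) k x :
  (forall y, y \in nbrs (tree_at s T0 k x m.+1) (x m) ->
     f k (update x m.+1 y) <= g k (update x m.+1 y)) ->
  step_mean s T0 m f k x <= step_mean s T0 m g k x.
Proof.
move=> fg; rewrite /step_mean ler_wpM2r ?invr_ge0 // big_seq [leRHS]big_seq.
exact: ler_sum.
Qed.

Lemma sum_pred1_uniq (R : pzSemiRingType) (L : seq nat) v : uniq L ->
  \sum_(y <- L) (y == v)%:R = (v \in L)%:R :> R.
Proof.
elim: L => [|a L IH] /=; first by rewrite big_nil.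
move=> /andP[aL /IH e]; rewrite big_cons e inE eq_sym; case: eqVneq => [->|_] /=.
  by rewrite (negbTE aL) addr0.
by rewrite add0r.
Qed.

Section Crossing.
Variables (R : realType) (s : nat) (T0 : graph) (n u v : nat).
Variable c : nat -> (nat -> nat) -> (nat -> nat) -> R.
Hypothesis c_adapted : forall m, adapted m.+1 m.+2 (c m).
Hypothesis c_ge0 : forall m k x, 0 <= c m k x.

Definition uncrossed m (x : nat -> nat) : R := (~~ ((x m == u) && (x m.+1 == v)))%:R.

Hypothesis c_mean : forall m k x,
  step_mean s T0 m (fun k x => c m k x * uncrossed m x) k x <= cross_rate R s T0 k x u v m.

(** One plus the time shown since [n] by a clock with increments [c m], killed at the first crossing
    from [u] to [v]. By [c_mean] the clock runs no faster than the crossing rate. *)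
Definition crossing_supermartingale N k x : R :=
  (\prod_(n <= m < N) uncrossed m x) * (1 + \sum_(n <= m < N) c m k x).

Local Notation M := crossing_supermartingale.

Lemma adapted_prod_uncrossed N : adapted N N.+1 (fun k x => \prod_(n <= m < N) uncrossed m x).
Proof.
move=> k k' x x' hk hx; rewrite big_nat_cond [RHS]big_nat_cond.
apply: eq_bigr => m /andP[/andP[_ hm] _]; rewrite /uncrossed !hx //.
exact: ltnW.
Qed.

Lemma adapted_sum_clock N : adapted N N.+1 (fun k x => \sum_(n <= m < N) c m k x).
Proof.
move=> k k' x x' hk hx; rewrite big_nat_cond [RHS]big_nat_cond.
apply: eq_bigr => m /andP[/andP[_ hm] _]; apply: c_adapted => i hi; [apply: hk|apply: hx].
  exact: leq_trans hi hm.
exact: leq_trans hi _.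
Qed.

Lemma adapted_crossing N : adapted N N.+1 (M N).
Proof.
move=> k k' x x' hk hx; rewrite /M.
by rewrite (adapted_prod_uncrossed hk hx) (adapted_sum_clock hk hx).
Qed.

Lemma crossing_ge0 N k x : 0 <= M N k x.
Proof.
by rewrite mulr_ge0 ?addr_ge0 ?sumr_ge0 ?prodr_ge0 // => m _; rewrite /uncrossed.
Qed.

Lemma cross_rate_le1 k x m : cross_rate R s T0 k x u v m <= 1.
Proof.
rewrite /cross_rate; case: andP => [[_ hv]|_]; last by rewrite mul0r.
have d0 : (0 < degree (tree_at s T0 k x m.+1) u)%N.
  by rewrite /degree; case: (nbrs _ _) hv.
by rewrite mul1r invf_le1 ?ltr0n // ler1n.
Qed.

(** An equality, except when [x m] has no neighbour: division by zero then makes the left side 0. *)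
Lemma step_mean_uncrossed m k x :
  step_mean s T0 m (fun _ => uncrossed m) k x <= 1 - cross_rate R s T0 k x u v m.
Proof.
rewrite /step_mean /cross_rate /degree; set L := nbrs _ (x m).
have -> : \sum_(y <- L) uncrossed m (update x m.+1 y) =
    (size L)%:R - ((x m == u) && (v \in L))%:R.
  have up y : uncrossed m (update x m.+1 y) = (~~ ((x m == u) && (y == v)))%:R.
    by rewrite /uncrossed /update eqxx (ltn_eqF (ltnSn m)).
  under eq_bigr => y _ do rewrite up.
  transitivity (\sum_(y <- L) (1 - ((x m == u) && (y == v))%:R : R)).
    by apply: eq_bigr => y _; case: (_ && _); rewrite ?subrr ?subr0.
  rewrite sumrB big_const_seq count_predT iter_addr_0; congr (_ - _).
  case: (x m == u) => /=; first by rewrite sum_pred1_uniq ?uniq_nbrs.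
  by rewrite big1.
have [L0|L0] := posnP (size L); last first.
  rewrite mulrBl divff ?pnatr_eq0 ?lt0n_neq0 // lerD2l lerN2.
  rewrite /L; case: eqVneq => [->|_] /=; last by rewrite !mul0r.
  by [].
rewrite L0 invr0 mulr0 subr_ge0 -/(degree _ u) -/(cross_rate R s T0 k x u v m).
exact: cross_rate_le1.
Qed.

(** With p the crossing probability and [S] the clock, killing costs at least p (1 + [S]) while the
    next increment gains at most p; as [S] is nonnegative, the cost covers the gain. *)
Lemma step_mean_crossing N k x : step_mean s T0 N (M N.+1) k x <= M N k x.
Proof.
have [Nn|nN] := ltnP N n.
  apply: (@le_trans _ _ (step_mean s T0 N (fun _ _ => 1) k x)).
    by apply: step_mean_le => y _; rewrite /M !big_geq ?mul1r ?addr0.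
  rewrite /M !big_geq ?(ltnW Nn) // mul1r addr0 /step_mean /degree.
  rewrite big_const_seq count_predT iter_addr_0.
  by case: (size _) => [|j]; rewrite ?mul0r // divff ?pnatr_eq0.
set A := \prod_(n <= m < N) uncrossed m x; set S := \sum_(n <= m < N) c m k x.
have upd y i : (i < N.+1)%N -> x i = update x N.+1 y i by move=> hi; rewrite /update ltn_eqF.
have -> : step_mean s T0 N (M N.+1) k x =
    A * ((1 + S) * step_mean s T0 N (fun _ => uncrossed N) k x +
         step_mean s T0 N (fun k x => c N k x * uncrossed N x) k x).
  rewrite /step_mean !mulrA -mulrDl mulrA; congr (_ / _).
  rewrite !big_distrr -big_split big_distrr /=; apply: eq_bigr => y _.
  rewrite /M !big_nat_recr //= -(@adapted_prod_uncrossed N k k x _ (fun _ _ => erefl) (upd y)).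
  rewrite -(@adapted_sum_clock N k k x _ (fun _ _ => erefl) (upd y)) -/A -/S.
  by ring.
have A0 : 0 <= A by apply: prodr_ge0 => m _; rewrite /uncrossed.
have S0 : 0 <= S by apply: sumr_ge0.
rewrite /M -/A -/S ler_wpM2l //.
have := step_mean_uncrossed N k x; have := c_mean N k x.
have := cross_rate_ge0 R s T0 k x u v N.
move: (cross_rate _ _ _ _ _ _ _ _) (step_mean _ _ _ _ _ _) (step_mean _ _ _ _ _ _) => p q1 q2.
by nra.
Qed.

End Crossing.

Section AlmostSure.
Context (R : realType) (d : measure_display) (Omega : measurableType d).
Context (P : probability Omega R).
Variables (s : nat) (T0 : graph) (x0 : nat) (xi X : nat -> {RV P >-> nat}).
Hypotheses (hX : is_TBRW s T0 x0 xi X).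

Local Notation path f w := (f (fun i => xi i w) (fun i => X i w)).

Lemma measurable_path_bool a b (A : (nat -> nat) -> (nat -> nat) -> bool) :
  adapted a b A -> measurable [set w | path A w].
Proof.
move=> hA; apply: (@measurable_adapted_set _ _ _ _ xi X a b (fun k x => is_true (A k x))).
by move=> k k' x x' hk hx; rewrite (hA k k' x x').
Qed.

Lemma integral_path_bool a b (A : (nat -> nat) -> (nat -> nat) -> bool) :
  adapted a b A ->
  (\int[P]_w (path (fun k x => (A k x)%:R : R) w)%:E = P [set w | path A w])%E.
Proof.
move=> hA; rewrite -[X in P X]setIT -integral_indic //; last exact: measurable_path_bool hA.
by apply: eq_integral => w _; rewrite indicE mem_setE /=.
Qed.

Lemma walk_ae : {ae P, forall w, forall n, walk s T0 (fun i => xi i w) (fun i => X i w) n}.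
Proof.
suff : {ae P, forall w, forall m, path (fun k x => x m.+1 \in nbrs (tree_at s T0 k x m.+1) (x m)) w}.
  by apply: filterS => w h n m _; exact: h.
apply: ae_foralln => m.
pose A (k x : nat -> nat) := x m.+1 \notin nbrs (tree_at s T0 k x m.+1) (x m).
have hA : adapted m.+1 m.+2 A.
  move=> k k' x x' hk hx; rewrite /A !hx // (@adapted_tree s T0 m.+1 k k' x x') // => i hi.
  by apply: hx; apply: leqW.
suff PA : P [set w | path A w] = 0%E.
  by exists [set w | path A w]; split=> [||w /negP //]; first exact: measurable_path_bool hA.
rewrite -(integral_path_bool hA).
rewrite (@integral_path_step _ _ _ _ _ _ _ _ _ hX m.+1 m (fun k x => (A k x)%:R)) //; last first.
  by move=> k k' x x' hk hx; rewrite (hA k k' x x').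
rewrite (_ : (fun w => _) = cst 0%E) ?integral0 //; apply/funext => w.
rewrite /step_mean big_seq big1 ?mul0r // => y hy.
rewrite /A /update eqxx (ltn_eqF (ltnSn m)).
rewrite (@adapted_tree s T0 m.+1 _ (fun i => xi i w) _ (fun i => X i w)) //= ?hy //.
by move=> i hi; rewrite ltn_eqF.
Qed.

(** The supermartingale has mean at most 1, so by Fatou its lower limit is integrable, hence finite
    almost everywhere. Without a crossing after [n] it equals one plus the clock, which therefore
    cannot diverge. *)
Lemma crossing_ae n u v (c : nat -> (nat -> nat) -> (nat -> nat) -> R) :
  (forall m, adapted m.+1 m.+2 (c m)) -> (forall m k x, 0 <= c m k x) ->
  (forall m k x, step_mean s T0 m (fun k x => c m k x * uncrossed R u v m x) k x
    <= cross_rate R s T0 k x u v m) ->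
  {ae P, forall w, unbounded_sum n (fun m => path (c m) w) ->
     exists m, [/\ (n <= m)%N, X m w = u & X m.+1 w = v]}.
Proof.
move=> hc c0 cm; pose M := crossing_supermartingale n u v c.
have M0 N k x : 0 <= M N k x by exact: crossing_ge0.
pose F N w := (path (M N) w)%:E.
have mF N : measurable_fun setT (F N).
  by apply/measurable_EFinP; apply: measurable_adapted; exact: adapted_crossing.
have F0 N w : (0 <= F N w)%E by rewrite lee_fin.
have intF N : (\int[P]_w F N w <= 1)%E.
  elim: N => [|N IH].
    rewrite (_ : F 0 = cst 1%E); last first.
      by apply/funext => w; rewrite /F /M /crossing_supermartingale !big_geq // mul1r addr0.
    by rewrite integral_cst // mul1e; exact: probability_le1.
  have aM : adapted N.+1 N.+2 (M N.+1) by exact: adapted_crossing.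
  apply: le_trans IH.
  rewrite /F (@integral_path_step _ _ _ _ _ _ _ _ _ hX N.+1 N (M N.+1)) //.
  apply: ge0_le_integral => //.
  - by move=> w _; rewrite lee_fin /step_mean divr_ge0 // sumr_ge0.
  - apply/measurable_EFinP; apply: measurable_adapted; exact: adapted_step_mean (ltnSn N) aM.
  - exact: (mF N).
  - by move=> w _; rewrite lee_fin; exact: step_mean_crossing.
pose L w := limn_einf (F ^~ w).
have L0 w : (0 <= L w)%E.
  rewrite /L limn_einf_lim; apply: lime_ge; first exact: is_cvg_einfs.
  by apply: nearW => m; apply: le_ereal_inf_tmp => _ [j _ <-].
have mL : measurable_fun setT L.
  rewrite /L /limn_einf; apply: measurableT_comp => //.
  by apply: measurable_fun_limn_esup => m; exact: measurableT_comp.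
have iL : P.-integrable setT L.
  apply/integrableP; split=> //; apply: (@le_lt_trans _ _ 1%E); last exact: ltry.
  rewrite (_ : (fun x => _) = L); last by apply/funext => w; rewrite gee0_abs.
  have fa := fatou P measurableT mF (fun N w _ => F0 N w); apply: (le_trans fa).
  rewrite limn_einf_lim; apply: lime_le; first exact: is_cvg_einfs.
  apply: nearW => m; apply: le_trans (intF m); apply: ereal_inf_lbound; exists m => //=.
have := integrable_ae measurableT iL.
apply: filterS => w /(_ I) Lfin unb; apply: contrapT => nocross.
have FE N : F N w = (1 + \sum_(n <= m < N) path (c m) w)%:E.
  rewrite /F /M /crossing_supermartingale big_nat_cond big1 ?mul1r // => m.
  move=> /andP[/andP[nm _] _]; rewrite /uncrossed; case: andP => // -[/eqP e1 /eqP e2].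
  by case: nocross; exists m.
have [l Ll] : exists l, L w = l%:E by exists (fine (L w)); rewrite fineK.
have [N0 hN0] := unb l.
suff : (l%:E < L w)%E by rewrite Ll ltxx.
apply: (@lt_le_trans _ _ (1 + l)%:E); first by rewrite lte_fin ltrDr.
rewrite /L limn_einf_lim; apply: lime_ge; first exact: is_cvg_einfs.
exists N0 => // N /= N0N; apply: le_ereal_inf_tmp => _ [j /= Nj <-].
rewrite FE lee_fin lerD2l; apply: le_trans hN0 _.
have [nN|Nn] := leqP n N0; last by rewrite big_geq ?(ltnW Nn) // sumr_ge0.
by rewrite [leRHS](@big_cat_nat _ _ _ N0) ?(leq_trans N0N) //= lerDl sumr_ge0.
Qed.
End AlmostSure.

Lemma step_mean_cst_le (R : realType) s T0 m (f : (nat -> nat) -> (nat -> nat) -> R) (a : R) k x :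
  0 <= a -> (forall y, f k (update x m.+1 y) <= a) -> step_mean s T0 m f k x <= a.
Proof.
move=> a0 fa; rewrite /step_mean /degree; set L := nbrs _ _.
have : \sum_(y <- L) f k (update x m.+1 y) <= \sum_(y <- L) a by apply: ler_sum.
rewrite big_const_seq count_predT iter_addr_0 => h.
have [L0|L0] := posnP (size L); first by rewrite L0 invr0 mulr0.
by rewrite ler_pdivrMr ?ltr0n // mulr_natr.
Qed.

Section Clocks.
Variables (R : realType) (s : nat) (T0 : graph).

Lemma adapted_cross_rate u v m :
  adapted m.+1 m.+1 (fun k x => cross_rate R s T0 k x u v m).
Proof.
move=> k k' x x' hk hx.
by rewrite /cross_rate (@adapted_tree s T0 m.+1 k k' x x' hk hx) hx.
Qed.

Lemma adapted_cross_ind u v' v m :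
  adapted m.+1 m.+2 (fun k x => cross_ind R s T0 k x u v' v m).
Proof.
move=> k k' x x' hk hx.
rewrite /cross_ind (@adapted_tree s T0 m.+1 k k' x x' hk) ?hx // => i hi.
by apply: hx; apply: leqW.
Qed.

Lemma cross_rate_mean u v m k x :
  step_mean s T0 m (fun k x => cross_rate R s T0 k x u v m * uncrossed R u v m x) k x
    <= cross_rate R s T0 k x u v m.
Proof.
apply: step_mean_cst_le => [|y]; first exact: cross_rate_ge0.
rewrite (@adapted_cross_rate u v m k k _ x) // => [|i hi]; last first.
  by rewrite /update ltn_eqF.
by rewrite ler_piMr ?cross_rate_ge0 // /uncrossed; case: (~~ _).
Qed.

(** A uniform step from [u] is no more likely to end at [v'] than at a given neighbour [v]. *)
Lemma cross_ind_mean u v' v m k x :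
  step_mean s T0 m (fun k x => cross_ind R s T0 k x u v' v m * uncrossed R u v m x) k x
    <= cross_rate R s T0 k x u v m.
Proof.
rewrite /step_mean /cross_rate; set L := nbrs (tree_at s T0 k x m.+1) (x m).
have up y : cross_ind R s T0 k (update x m.+1 y) u v' v m =
    ((x m == u) && (v \in nbrs (tree_at s T0 k x m.+1) u))%:R * (y == v')%:R.
  rewrite /cross_ind /update eqxx (ltn_eqF (ltnSn m)).
  rewrite (@adapted_tree s T0 m.+1 k k _ x) //; last by move=> i hi; rewrite ltn_eqF.
  by rewrite -natrM mulnb andbA.
have h : \sum_(y <- L) cross_ind R s T0 k (update x m.+1 y) u v' v m *
    uncrossed R u v m (update x m.+1 y) <=
    ((x m == u) && (v \in nbrs (tree_at s T0 k x m.+1) u))%:R.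
  apply: (@le_trans _ _ (\sum_(y <- L)
      ((x m == u) && (v \in nbrs (tree_at s T0 k x m.+1) u))%:R * (y == v')%:R)).
    apply: ler_sum => y _; rewrite up /uncrossed; case: (~~ _); rewrite ?mulr1 // mulr0.
    by rewrite mulr_ge0.
  rewrite -mulr_sumr sum_pred1_uniq ?uniq_nbrs //.
  by rewrite ler_piMr //; case: (v' \in L).
apply: (@le_trans _ _ (((x m == u) && (v \in nbrs (tree_at s T0 k x m.+1) u))%:R /
    (degree (tree_at s T0 k x m.+1) (x m))%:R)).
  by rewrite ler_wpM2r ?invr_ge0.
by case: eqVneq => [->|] //=; rewrite !mul0r.
Qed.

End Clocks.

(** * Divergence of the inverse tree sizes *)

Section SlowEnvironment.
Variable R : realType.

Lemma unbounded_sum_cst (n : nat) (a : R) : 0 < a -> unbounded_sum n (fun=> a).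
Proof.
move=> a0 K; exists (n + Num.bound (`|K| / a))%N.
rewrite sumr_const_nat addKn -mulr_natr mulrC -ler_pdivrMr //.
apply: ltW; apply: le_lt_trans (archi_boundP _); last by rewrite divr_ge0 // ltW.
by rewrite ler_wpM2r ?invr_ge0 ?ler_norm // ltW.
Qed.

Lemma unbounded_sum_le (n : nat) (u v : nat -> R) :
  (forall m, (n <= m)%N -> u m <= v m) -> unbounded_sum n u -> unbounded_sum n v.
Proof.
move=> uv hu K; have [N hN] := hu K; exists N; apply: le_trans hN _.
by rewrite big_nat_cond [leRHS]big_nat_cond; apply: ler_sum => m /andP[/andP[/uv]].
Qed.

Lemma unbounded_sumZ (n : nat) (a : R) (u : nat -> R) : 0 < a ->
  unbounded_sum n u -> unbounded_sum n (fun m => a * u m).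
Proof.
move=> a0 hu K; have [N hN] := hu (K / a); exists N.
by rewrite -mulr_sumr mulrC -ler_pdivrMr.
Qed.

Lemma unbounded_sum_head (m n : nat) (u : nat -> R) : (m <= n)%N ->
  (forall i, 0 <= u i) -> unbounded_sum n u -> unbounded_sum m u.
Proof.
move=> mn u0 hu K; have [N hN] := hu K; exists N; apply: le_trans hN _.
have [nN|Nn] := leqP n N; last by rewrite big_geq ?(ltnW Nn) // sumr_ge0.
by rewrite [leRHS](@big_cat_nat _ _ _ n) //= lerDr sumr_ge0.
Qed.

Lemma nneseries_unbounded (u : nat -> R) n : (forall i, (n <= i)%N -> 0 <= u i) ->
  (\sum_(n <= i <oo) (u i)%:E = +oo)%E -> unbounded_sum n u.
Proof.
move=> u0 hu K; apply: contrapT => h.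
have : (\sum_(n <= i <oo) (u i)%:E <= K%:E)%E.
  apply: lime_le; first by apply: is_cvg_nneseries_cond => i ni _; rewrite lee_fin u0.
  apply: nearW => N; rewrite sumEFin lee_fin leNgt; apply/negP => h'; apply: h.
  by exists N; rewrite ltW.
by rewrite hu leye_eq.
Qed.

(** If [S] vanishes identically the terms are constant. Otherwise eventually 1 <= [S m] <=
    [(c + 1) * g m], so [C + S m] is at most [C.+1 * (c + 1) * g m] and the series of [g] is a
    minorant up to a factor. *)
Lemma slow_sum_unbounded (c : R) (g : nat -> R) (S : nat -> nat) (C : nat) :
  0 < c -> (forall n, (1 <= n)%N -> 0 < g n) ->
  (\sum_(1 <= n <oo) ((g n)^-1)%:E = +oo)%E ->
  {homo S : m n / (m <= n)%N} ->
  (limn_esup (fun n => ((S n)%:R / g n)%:E) <= c%:E)%E -> (0 < C)%N ->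
  unbounded_sum 0 (fun j => (C + S j)%N%:R^-1 : R).
Proof.
move=> c0 g0 hg mS lS C0.
have [[N1 S1]|S0] := pselect (exists n, (0 < S n)%N); last first.
  apply: unbounded_sum_le (unbounded_sum_cst 0 (_ : 0 < C%:R^-1)); last first.
    by rewrite invr_gt0 ltr0n.
  move=> m _; case: (posnP (S m)) => [->|Sm]; first by rewrite addn0.
  by case: S0; exists m.
have : (limn_esup (fun n => ((S n)%:R / g n)%:E) < (c + 1)%:E)%E.
  by apply: le_lt_trans lS _; rewrite lte_fin ltrDl.
move=> /ereal_inf_lt[_ [A [N2 _ hA] <-] hsup].
have bd n : (N2 <= n)%N -> (1 <= n)%N -> (S n)%:R <= (c + 1) * g n.
  move=> N2n n1; rewrite -ler_pdivrMr ?g0 //.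
  have : (((S n)%:R / g n)%:E < (c + 1)%:E)%E.
    apply: le_lt_trans hsup; apply: ereal_sup_ubound; exists n => //; exact: hA.
  by rewrite lte_fin => /ltW.
pose N := (maxn N1 N2).+1.
apply: (@unbounded_sum_head 0 N) => //.
have a0 : 0 < (C.+1%:R * (c + 1))^-1 by rewrite invr_gt0 mulr_gt0 ?ltr0n // addr_gt0.
have g'0 i : (1 <= i)%N -> 0 <= (g i)^-1 by move=> i1; rewrite invr_ge0 ltW // g0.
have hN : (1 <= N)%N by [].
apply: unbounded_sum_le (unbounded_sumZ a0 (unbounded_sum_tail hN (nneseries_unbounded g'0 hg))).
move=> m Nm; have m1 : (1 <= m)%N by exact: leq_trans Nm.
have SM : (0 < S m)%N.
  by apply: leq_trans S1 (mS _ _ _); apply: leq_trans (ltnW Nm); rewrite leq_maxl.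
rewrite -invfM lef_pV2 ?posrE ?ltr0n ?addn_gt0 ?C0 //; last first.
  by rewrite !mulr_gt0 ?ltr0n ?g0 // addr_gt0.
apply: (@le_trans _ _ (C.+1%:R * (S m)%:R)).
  rewrite -natrM ler_nat mulSn addnC leq_add2l.
  by rewrite leq_pmulr.
rewrite -mulrA ler_wpM2l // bd //.
by apply: leq_trans (ltnW Nm); rewrite leq_maxr.
Qed.

End SlowEnvironment.

(** * Almost sure recurrence *)

Section Recurrent.
Context (R : realType) (d : measure_display) (Omega : measurableType d).
Context (P : probability Omega R).
Variables (s : nat) (T0 : graph) (x0 r : nat) (xi X : nat -> {RV P >-> nat}).
Hypotheses (hX : is_TBRW s T0 x0 xi X).
Hypotheses (s0 : (0 < s)%N) (s_even : ~~ odd s).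
Hypotheses (hT0 : bridged_tree r T0) (hx0 : (x0 < nverts T0)%N).
Variables (c : R) (g : nat -> R).
Hypotheses (hc : 0 < c) (hg : forall n, (1 <= n)%N -> 0 < g n).
Hypothesis hgdiv : (\sum_(1 <= n <oo) ((g n)^-1)%:E)%E = +oo%E.
Hypothesis hlimsup :
  P [set w | (limn_esup (fun n => ((env_sum s xi n w)%:R / g n)%:E) <= c%:E)%E] = 1%E.

Local Notation path f w := (f (fun i => xi i w) (fun i => X i w)).

Lemma prob1_ae (A : set Omega) : measurable A -> P A = 1%E -> {ae P, forall w, A w}.
Proof.
move=> mA PA; exists (~` A); split => //; first exact: measurableC.
by rewrite probability_setC // PA subee.
Qed.

Lemma start_ae : {ae P, forall w, X 0 w = x0}.
Proof.
apply: prob1_ae hX.1; exact: (measurable_RV_preimage (X 0) [set x0]).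
Qed.

Lemma slow_ae : {ae P, forall w, forall C, (0 < C)%N ->
  unbounded_sum 0 (fun j => ((C + \sum_(1 <= i < j.+1) xi (s * i)%N w)%N%:R)^-1 : R)}.
Proof.
have : {ae P, forall w, (limn_esup (fun n => ((env_sum s xi n w)%:R / g n)%:E) <= c%:E)%E}.
  apply: prob1_ae hlimsup.
  have mL : measurable_fun setT (fun w => limn_esup (fun n => ((env_sum s xi n w)%:R / g n)%:E)).
    apply: measurable_fun_limn_esup => n; apply/measurable_EFinP.
    apply: (@measurable_adapted _ _ _ _ xi X (s * n).+1 0 _ _
      (fun k _ => (\sum_(1 <= j < n.+1) k (s * j)%N)%N%:R / g n)) => k k' x x' hk _.
    congr (_%:R / _); rewrite big_nat_cond [RHS]big_nat_cond.
    apply: eq_bigr => i /andP[/andP[_ hi] _]; apply: hk.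
    by rewrite ltnS leq_mul.
  have := mL measurableT _ (emeasurable_itv `]-oo, c%:E]); rewrite setTI.
  by congr measurable; apply/seteqP; split=> w /=; rewrite in_itv.
apply: filterS => w hw C C0.
apply: (slow_sum_unbounded hc hg hgdiv _ hw C0) => m n mn.
rewrite /env_sum [leqRHS](@big_cat_nat _ _ _ m.+1) //=.
by rewrite leq_addr.
Qed.

Lemma rate_cross_ae n u v : {ae P, forall w,
  unbounded_sum n (fun m => path (fun k x => cross_rate R s T0 k x u v m) w) ->
  exists m, [/\ (n <= m)%N, X m w = u & X m.+1 w = v]}.
Proof.
apply: (@crossing_ae _ _ _ _ s T0 x0 xi X hX n u v (fun m k x => cross_rate R s T0 k x u v m)) => [m|m k x|m k x].
- by apply: adaptedW (@adapted_cross_rate R s T0 u v m).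
- exact: cross_rate_ge0.
- exact: cross_rate_mean.
Qed.

Lemma ind_cross_ae n u v' v : {ae P, forall w,
  unbounded_sum n (fun m => path (fun k x => cross_ind R s T0 k x u v' v m) w) ->
  exists m, [/\ (n <= m)%N, X m w = u & X m.+1 w = v]}.
Proof.
apply: (@crossing_ae _ _ _ _ s T0 x0 xi X hX n u v (fun m k x => cross_ind R s T0 k x u v' v m)) => [m|m k x|m k x].
- exact: adapted_cross_ind.
- by [].
- exact: cross_ind_mean.
Qed.

(** The countably many null sets, one for each choice of times and vertices, are merged; off them
    the trajectory meets the hypotheses of [visits_io]. *)
Lemma visits_io_ae : {ae P, forall w, forall n z m,
  (z < nverts (tree_proc s T0 xi X n w))%N -> exists m', (m <= m')%N /\ X m' w = z}.
Proof.
have h1 : {ae P, forall w, forall n u v,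
    unbounded_sum n (fun m => path (fun k x => cross_rate R s T0 k x u v m) w) ->
    exists m, [/\ (n <= m)%N, X m w = u & X m.+1 w = v]}.
  by do 3![apply: ae_foralln => ?]; exact: rate_cross_ae.
have h2 : {ae P, forall w, forall n u v' v,
    unbounded_sum n (fun m => path (fun k x => cross_ind R s T0 k x u v' v m) w) ->
    exists m, [/\ (n <= m)%N, X m w = u & X m.+1 w = v]}.
  by do 4![apply: ae_foralln => ?]; exact: ind_cross_ae.
have h3 : {ae P, forall w, X 0 w = x0 /\ forall n, walk s T0 (fun i => xi i w) (fun i => X i w) n}.
  by move: start_ae (walk_ae hX); apply: filterS2.
have h4 : {ae P, forall w, (forall n u v,
    unbounded_sum n (fun m => path (fun k x => cross_rate R s T0 k x u v m) w) ->
    exists m, [/\ (n <= m)%N, X m w = u & X m.+1 w = v]) /\ forall n u v' v,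
    unbounded_sum n (fun m => path (fun k x => cross_ind R s T0 k x u v' v m) w) ->
    exists m, [/\ (n <= m)%N, X m w = u & X m.+1 w = v]}.
  by move: h1 h2; apply: filterS2.
move: h3 h4 slow_ae; apply: filterS3 => w [w0 ww] [w1 w2] ws n z m hz.
apply: (@visits_io R s T0 (fun i => xi i w) (fun i => X i w) r _ _ _ _ _ _ _ _ n) => //.
by rewrite /= w0.
Qed.

Lemma measurable_state n T x : measurable (state_event s T0 xi X n T x).
Proof.
apply: (@measurable_adapted_set _ _ _ _ xi X n n.+1
  (fun k y => tree_at s T0 k y n = T /\ y n = x)) => k k' y y' hk hy.
by rewrite (@adapted_tree s T0 n k k' y y') ?hy // => i hi; apply: hy; apply: leqW.
Qed.

Lemma visits_infinitely_oftenE z :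
  visits_infinitely_often X z = \bigcap_m \bigcup_(i in [set i | (m <= i)%N]) (X i @^-1` [set z]).
Proof.
apply/seteqP; split=> w /=.
  move=> h m _; apply: contrapT => h'; apply: h.
  apply: (@sub_finite_set _ _ `I_m); last exact: finite_II.
  move=> i /= Xi; rewrite ltnNge; apply/negP => mi; apply: h'; by exists i.
move=> h /finite_seqP[l hl]; have [i /= mi Xi] := h (\max_(j <- l) j).+1 I.
have il : [set` l] i by rewrite -hl.
by have := @leq_bigmax_seq _ l xpredT id i il isT; rewrite leqNgt mi.
Qed.

Lemma tbrw_recurrent : recurrent s T0 xi X.
Proof.
move=> n T x z PB zT; rewrite /cond_prob.
set B := state_event _ _ _ _ _ _ _ in PB *; set V := visits_infinitely_often _ _.
have mB : measurable B by exact: measurable_state.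
have mV : measurable V.
  rewrite /V visits_infinitely_oftenE.
  apply: bigcapT_measurable => m; apply: bigcup_measurable => i _.
  exact: measurable_RV_preimage.
have PVB : P (V `&` B) = P B.
  have [N [mN PN hN]] := visits_io_ae.
  rewrite setIC [RHS](@measureDI _ _ _ P B V) //.
  rewrite [X in _ = (X + _)%E](@subset_measure0 _ _ _ P _ N) ?add0e //.
    exact: measurableD.
  move=> w [Bw Vw]; apply: hN => /= h; apply: Vw; rewrite /V visits_infinitely_oftenE.
  by move=> m _; have [|m' [mm' e]] := h n z m; [case: Bw => -> _|exists m'].
by rewrite PVB divff // gt_eqF // fine_gt0 // PB /= ltey_eq fin_num_measure.
Qed.

End Recurrent.

(** * Deep vertices *)

Definition extend G y (H : nat -> nat) : nat -> nat :=
  fun v => if (v < nverts G)%N then H v else H y.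

(* [H] vanishes at [r] and is harmonic for the simple random walk on [G] off
   [r] and [x]; at [x] its mean over the neighbours is [H x - 1 / degree]. *)
Definition harmonic_toward r x G (H : nat -> nat) : Prop :=
  H r = 0%N /\ forall u, (u < nverts G)%N -> u != r ->
    (\sum_(v <- nbrs G u) H v + (u == x) = degree G u * H u)%N.

Lemma sum_extend G y H u : (\sum_(v <- nbrs G u) extend G y H v = \sum_(v <- nbrs G u) H v)%N.
Proof.
rewrite big_seq [RHS]big_seq; apply: eq_bigr => v; rewrite mem_nbrs => /andP[hv _].
by rewrite /extend hv.
Qed.

(** At [y] both sides gain [k * H y]; a new leaf has [y] as its only neighbour, at the same
    height. *)
Lemma harmonic_attach r x G H y k : is_graph G ->
  (r < nverts G)%N -> (x < nverts G)%N -> (y < nverts G)%N ->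
  harmonic_toward r x G H -> harmonic_toward r x (attach G y k) (extend G y H).
Proof.
move=> gG hr hx hy [Hr HH]; split=> [|u hu nur]; first by rewrite /extend hr.
have [uN|Nu] := ltnP u (nverts G).
  rewrite /degree nbrs_attach // big_cat size_cat /= sum_extend [extend _ _ _ u]/extend uN.
  rewrite mulnDl -HH //; case: eqVneq => [->|_] /=; last by rewrite big_nil !addn0.
  have -> : (\sum_(v <- iota (nverts G) k) extend G y H v = k * H y)%N.
    transitivity (\sum_(v <- iota (nverts G) k) H y)%N.
      rewrite big_seq [RHS]big_seq; apply: eq_bigr => v.
      by rewrite mem_iota => /andP[hv _]; rewrite /extend ltnNge hv.
    by rewrite big_const_seq count_predT size_iota iter_addn_0 mulnC.
  by rewrite size_iota addnAC.
rewrite /degree (nbrs_attach_new gG hy) ?Nu //= big_seq1 /extend hy ltnNge Nu /= mul1n.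
by rewrite gtn_eqF ?addn0 // (leq_trans hx).
Qed.

(** Raising one new leaf of [x] by 1 repairs the defect at [x], whose neighbour sum grows by 1, and
    moves the defect to that leaf, which now exceeds its only neighbour by 1. *)
Lemma harmonic_deepen r x G H k : is_graph G ->
  (r < nverts G)%N -> (x < nverts G)%N -> (0 < k)%N -> harmonic_toward r x G H ->
  harmonic_toward r (nverts G) (attach G x k)
    (fun v => (extend G x H v + (v == nverts G))%N).
Proof.
move=> gG hr hx k0 hH; have [Hr HH] := harmonic_attach k gG hr hx hx hH.
split=> [|u hu nur]; first by rewrite Hr ltn_eqF.
have sumw : (\sum_(v <- nbrs (attach G x k) u) (v == nverts G) = (u == x))%N.
  have := @sum_pred1_uniq nat (nbrs (attach G x k) u) (nverts G) (uniq_nbrs _ _).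
  rewrite (eq_bigr (fun y => (y == nverts G) : nat)) => [->|v _]; last by rewrite natn.
  rewrite natn (nbrs_adj _ _ (attach_graph k gG hx)) adj_attach leqnn -{2}[nverts G]addn0 ltn_add2l k0 andbT.
  rewrite (gtn_eqF hx) orbF; case: (boolP (adj G u _)) => [/(proj1 gG)[_]|_].
    by rewrite ltnn.
  by rewrite orFb andbT.
rewrite /= big_split /= sumw mulnDr -HH //; congr (_ + _)%N.
case: eqVneq => [->|nuw]; last by rewrite /= muln0.
have hw : (nverts G <= nverts G < nverts G + k)%N by rewrite leqnn -{1}[nverts G]addn0 ltn_add2l.
by rewrite /degree (nbrs_attach_new gG hx hw).
Qed.

(** Walk to the root, use the loop once, and return the same way. *)
Lemma odd_closed_walk r G v : bridged_tree r G -> (v < nverts G)%N ->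
  exists p, [/\ path (adj G) v p, last v p = v & odd (size p)].
Proof.
move=> [[bG sG] cG hr lr _] hv; have [p pp lp] := cG _ _ hv hr.
exists (p ++ r :: rev (belast v p)); split.
- rewrite cat_path pp lp /= lr eqxx /= -{1}lp rev_path.
  by apply: sub_path pp => a b; rewrite sG.
- rewrite last_cat /=; case: p pp lp => [_ /= -> //|a p _ _ /=].
  by rewrite rev_cons last_rcons.
- by rewrite size_cat /= size_rev size_belast addnS oddS oddD addbb.
Qed.

(** * Reachability of deep vertices in a fixed positive environment *)

Section Reach.
Variables (s : nat) (T0 : graph) (x0 r : nat) (k : nat -> nat).
Hypotheses (s0 : (0 < s)%N) (s_even : ~~ odd s) (k0 : forall i, (0 < k i)%N).
Hypotheses (hT0 : bridged_tree r T0) (hx0 : (x0 < nverts T0)%N).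

Definition reach n G v := exists x, [/\ x 0 = x0, walk s T0 k x n,
  tree_at s T0 k x n = G & x n = v].

Definition grow n G v := if (s %| n)%N then attach G v (k n) else G.

Lemma reach_bridged n G v : reach n G v -> bridged_tree r G /\ (v < nverts G)%N.
Proof.
move=> [x [e0 hw <- <-]]; have hx : (x 0 < nverts T0)%N by rewrite e0.
exact: (walk_treeP hT0 hx hw (leqnn n)).
Qed.

Lemma reach_step n G v y : reach n G v -> y \in nbrs (grow n G v) v -> reach n.+1 (grow n G v) y.
Proof.
move=> [x [e0 hw eT ex]] hy.
have tE m : (m <= n.+1)%N -> tree_at s T0 k (update x n.+1 y) m = tree_at s T0 k x m.
  move=> mn; apply: adapted_tree => // i hi.
  by rewrite /update ltn_eqF // (leq_trans hi).
have gE : tree_at s T0 k x n.+1 = grow n G v by rewrite /= eT ex.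
exists (update x n.+1 y); split; rewrite ?tE ?gE //; last by rewrite /update eqxx.
move=> i; rewrite ltnS => hi; rewrite tE // /update eqSS (ltn_eqF (hi : (i < n.+1)%N)).
move: hi; rewrite leq_eqVlt => /predU1P[->|hi]; first by rewrite eqxx gE ex.
by rewrite ltn_eqF //; exact: hw.
Qed.

(** Growth only adds edges, so any path of the current tree can be followed. [I] stands for
    properties that survive growth away from [w]; the path may end at [w], since no growth happens
    there before the next step. *)
Lemma reach_path w (I : graph -> Prop) :
  (forall G v j, I G -> bridged_tree r G -> (v < nverts G)%N -> v != w -> I (attach G v j)) ->
  forall p n G v, reach n G v -> path (adj G) v p -> w \notin belast v p -> I G ->
  exists G', [/\ reach (n + size p) G' (last v p), I G' &
                 forall a b, adj G a b -> adj G' a b].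
Proof.
move=> hI; elim=> [|a p IH] n G v rG /=; first by move=> _ _ IG; exists G; rewrite addn0.
move=> /andP[va pp]; rewrite inE negb_or => /andP[nwv wp] IG.
have [bT hv] := reach_bridged rG.
have sub b c : adj G b c -> adj (grow n G v) b c.
  by rewrite /grow; case: ifP => // _; apply: adj_attachW.
have IG1 : I (grow n G v).
  by rewrite /grow; case: ifP => // _; apply: hI => //; rewrite eq_sym.
have gG : is_graph (grow n G v).
  rewrite /grow; have [gG _ _ _ _] := bT; case: ifP => // _; exact: attach_graph.
have rG1 : reach n.+1 (grow n G v) a by apply: reach_step => //; rewrite nbrs_adj // sub.
have [G' [rG' IG' sG']] := IH _ _ _ rG1 (sub_path sub pp) wp IG1.
by exists G'; split=> [||b c /sub/sG'//]; rewrite -?addSnnS.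
Qed.

(** The walker shuttles along the edge until the first multiple of [s]. It is at [v] only at odd
    times, which are no growth times as [s] is even, so the tree does not change. *)
Lemma reach_wait j m G w v : reach m G w -> adj G w v -> ~~ odd m -> (s %| m + j.*2)%N ->
  exists m', (s %| m')%N /\ reach m' G w.
Proof.
elim: j m => [|j IH] m rm wv em; first by rewrite addn0 => sm; exists m.
have [sm _|sm sj] := boolP (s %| m)%N; first by exists m.
have [[gG _ _ _ _] _] := reach_bridged rm; have [_ sG] := gG.
have ev i : (s %| i)%N -> ~~ odd i.
  by move=> /dvdnP[q ->]; rewrite oddM (negbTE s_even) andbF.
have sm1 : ~~ (s %| m.+1)%N by apply/negP => /ev; rewrite oddS negbK (negbTE em).
have r1 : reach m.+1 G v.
  by have := @reach_step m G w v rm; rewrite /grow (negbTE sm) nbrs_adj //; apply.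
have r2 : reach m.+2 G w.
  by have := @reach_step m.+1 G v w r1; rewrite /grow (negbTE sm1) (nbrs_adj _ _ gG) sG; apply.
apply: (IH m.+2) => //; first by rewrite /= negbK.
by rewrite !addSn -!addnS -doubleS.
Qed.

Lemma path_nverts_notin G v p : is_graph G -> (v < nverts G)%N ->
  path (adj G) v p -> nverts G \notin v :: p.
Proof.
move=> gG hv pp; have -> : (nverts G \in v :: p) = (nverts G \in p).
  by rewrite inE gtn_eqF.
elim: p v pp {hv} => [|a p IH] v //= /andP[/(proj1 gG)[_ ha] /IH].
by rewrite inE (gtn_eqF ha).
Qed.

Lemma reach_root : exists n G, (s %| n)%N /\ reach n G r.
Proof.
have r0 : reach 0 T0 x0 by exists (fun=> x0).
have [gG cG hr lr _] := hT0; have [p pp lp] := cG _ _ hx0 hr.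
(* Uses of the loop pad the length of the path to a multiple of [s]. *)
pose q := p ++ nseq (s * size p - size p) r.
have pq : path (adj T0) x0 q.
  by rewrite cat_path pp lp /=; elim: (_ - _)%N => //= j IH; rewrite lr eqxx IH.
have lq : last x0 q = r by rewrite last_cat lp; elim: (_ - _)%N.
(* No invariant has to be kept here, so the vertex to be avoided is one outside the tree. *)
have nq : nverts T0 \notin belast x0 q.
  apply: contra (path_nverts_notin gG hx0 pq); exact: mem_belast.
have [|G [rG _ _]] := @reach_path (nverts T0) (fun _ => True) _ q 0 T0 x0 r0 pq nq I; first by [].
exists (size q), G; rewrite lq in rG; split=> //.
by rewrite size_cat size_nseq subnKC ?dvdn_mulr // leq_pmull.
Qed.

Definition deep D v G := exists H, [/\ harmonic_toward r v G H, H v = D & forall u, (H u <= D)%N].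

Lemma deep_attach D v G y j : bridged_tree r G -> (v < nverts G)%N -> (y < nverts G)%N ->
  deep D v G -> deep D v (attach G y j).
Proof.
move=> [gG _ hr _ _] hv hy [H [hH Hv HD]]; exists (extend G y H); split.
- exact: harmonic_attach.
- by rewrite /extend hv.
- by move=> u; rewrite /extend; case: ifP.
Qed.

Lemma deep_deepen D v G j : bridged_tree r G -> (v < nverts G)%N -> (0 < j)%N ->
  deep D v G -> deep D.+1 (nverts G) (attach G v j).
Proof.
move=> [gG _ hr _ _] hv j0 [H [hH Hv HD]]; eexists; split.
- exact: harmonic_deepen hH.
- by rewrite /= eqxx /extend ltnn Hv addn1.
- move=> u; rewrite -addn1 leq_add //; last by case: (u == _).
  by rewrite /extend; case: ifP.
Qed.

(** One level per round: growth at [v] creates a leaf [w] one higher, on which the walker must stand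
    at a growth time. An odd closed walk from [v], which the loop provides, followed by the step to
    [w] gives the right parity; shuttling does the rest. No growth occurs at [w] meanwhile, so it
    keeps a single neighbour. *)
Lemma reach_deep D : exists n G v, [/\ (s %| n)%N, reach n G v, deep D v G &
  (0 < D)%N -> exists p, nbrs G v = [:: p]].
Proof.
elim: D => [|D [n [G [v [sn rG dG _]]]]].
  have [n [G [sn rG]]] := reach_root; exists n, G, r; split=> //.
  exists (fun=> 0%N); split=> //; split=> // u _ nur.
  by rewrite (negbTE nur) addn0 muln0 big1.
have [bT hv] := reach_bridged rG; have [gG _ _ _ _] := bT.
set w := nverts G; set G1 := attach G v (k n).
have bT1 : bridged_tree r G1 by exact: attach_bridged.
have gG1 : is_graph G1 by have [] := bT1.
have hw : (w < nverts G1)%N by rewrite /= -addn1 leq_add2l.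
have [p [pp lp op]] := odd_closed_walk bT hv.
case: p pp lp op => [//|a p] pp lp op.
have notw := path_nverts_notin gG hv pp.
move: pp => /= /andP[va pp].
have r1 : reach n.+1 G1 a.
  by have := @reach_step n G v a rG; rewrite /grow sn nbrs_adj //; apply; exact: adj_attachW.
pose I G' := [/\ deep D.+1 w G', nbrs G' w = [:: v] & (w < nverts G')%N].
have IG1 : I G1.
  split=> //; first exact: deep_deepen.
  by apply: nbrs_attach_new => //; rewrite leqnn.
have Iatt G' y j : I G' -> bridged_tree r G' -> (y < nverts G')%N -> y != w -> I (attach G' y j).
  move=> [dG' nG' wG'] bT' hy nyw; split.
  - exact: deep_attach.
  - have [gG' _ _ _ _] := bT'.
    by rewrite nbrs_attach // nG' eq_sym (negbTE nyw).
  - exact: ltn_addr.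
have p1 : path (adj G1) a (rcons p w).
  rewrite rcons_path (sub_path _ pp) => [|b c]; last exact: adj_attachW.
  by rewrite /= -[last a p]/(last v (a :: p)) lp adj_attach eqxx leqnn -ltn_subLR // subnn k0 !orbT.
have nw : w \notin belast a (rcons p w).
  by rewrite belast_rcons; apply: contra notw => h; rewrite inE h orbT.
have [G2 [r2 [dG2 nG2 wG2] _]] := reach_path Iatt r1 p1 nw IG1.
rewrite last_rcons size_rcons in r2.
have wv : adj G2 w v.
  have : v \in nbrs G2 w by rewrite nG2 inE.
  by rewrite mem_nbrs => /andP[].
have em : ~~ odd (n.+1 + (size p).+1).
  have en : odd n = false by move: sn => /dvdnP[q ->]; rewrite oddM (negbTE s_even) andbF.
  by move: op; rewrite /= => /negbTE op; rewrite oddD !oddS en op.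
have [j sj] : exists j, (s %| n.+1 + (size p).+1 + j.*2)%N.
  set m := (n.+1 + _)%N in em *.
  (* Waiting until time [s * m] suffices; the delay is even because [m] and [s] are. *)
  exists ((s * m - m)./2); rewrite halfK oddB ?leq_pmull // oddM (negbTE s_even) (negbTE em) /=.
  by rewrite subn0 subnKC ?dvdn_mulr // leq_pmull.
have [m' [sm' rm']] := reach_wait r2 wv em sj.
by exists m', G2, w; split=> // _; exists v.
Qed.

(* All neighbours of [v] but one are leaves. *)
Definition fan v G := exists p, forall y, y \in nbrs G v -> y != p -> nbrs G y = [:: v].

(** From a deep vertex with one neighbour at a growth time, grow, step to a new leaf and come back
    two time units later: all neighbours except the old one are now leaves. *)
Lemma reach_deep_fan D : (0 < D)%N -> exists q G v,
  [/\ reach (s * q).+2 G v, deep D v G, v != r, fan v G & (1 < degree G v)%N].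
Proof.
move=> D0; have [n [G [v [sn rG dG /(_ D0)[p np]]]]] := reach_deep D.
have [bT hv] := reach_bridged rG; have [gG _ hr _ _] := bT.
set w := nverts G; set G1 := attach G v (k n).
have nw : nbrs G1 w = [:: v].
  by apply: nbrs_attach_new => //; rewrite leqnn -ltn_subLR // subnn k0.
have nv : nbrs G1 v = p :: iota w (k n) by rewrite nbrs_attach // np eqxx.
have r1 : reach n.+1 G1 w.
  have := @reach_step n G v w rG; rewrite /grow sn -/G1; apply.
  by rewrite nv inE mem_iota leqnn -ltn_subLR // subnn k0 orbT.
have sn1 : ~~ (s %| n.+1)%N.
  apply/negP => /dvdnP[q' eq']; move: sn => /dvdnP[q eq].
  by have := congr1 odd eq'; rewrite oddS eq !oddM (negbTE s_even) !andbF.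
have r2 : reach n.+2 G1 v.
  by have := @reach_step n.+1 G1 w v r1; rewrite /grow (negbTE sn1) nw inE eqxx; apply.
case/dvdnP: sn r2 => q -> r2; exists q, G1, v; rewrite mulnC; split=> //.
- exact: deep_attach.
- by apply/eqP => evr; case: dG => H [[Hr _] Hv _]; rewrite -Hv evr Hr in D0.
- exists p => y; rewrite nv inE => /predU1P[->|]; first by rewrite eqxx.
  by rewrite mem_iota => hy _; exact: nbrs_attach_new.
- by rewrite /degree nv /= size_iota ltnS.
Qed.

End Reach.

(** * Excursions from a deep vertex *)

Lemma step_mean_ge0 (R : realType) s T0 m (f : (nat -> nat) -> (nat -> nat) -> R) k x :
  (forall k x, 0 <= f k x) -> 0 <= step_mean s T0 m f k x.
Proof. by move=> f0; rewrite /step_mean divr_ge0 // sumr_ge0. Qed.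

Section Excursion.
Variables (s : nat) (T0 : graph) (x0 r : nat).
Hypotheses (s_even : ~~ odd s) (hT0 : bridged_tree r T0) (hx0 : (x0 < nverts T0)%N).
Variables (n1 : nat) (T : graph) (a D : nat) (H : nat -> nat).
Hypotheses (n1_even : ~~ odd n1) (bT : bridged_tree r T) (haT : (a < nverts T)%N) (nar : a != r).
Hypotheses (hH : harmonic_toward r a T H) (Ha : H a = D) (HD : forall u, (H u <= D)%N).
Hypotheses (fanT : fan a T) (degT : (1 < degree T a)%N).

(** [H] transported along the growth after time [n1]. The extension is also made at times without
    growth, where it alters no value on the tree. *)
Fixpoint heights m (k x : nat -> nat) : nat -> nat :=
  if m is m'.+1 then
    if (m' < n1)%N then H else extend (tree_at s T0 k x m') (x m') (heights m' k x)
  else H.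

Definition fertile m (k x : nat -> nat) : bool := [&& (s %| m)%N, x m == a & (0 < k m)%N].

(** Counting starts at 1 so that the potential does not vanish at time [n1]; the count still stays
    below the degree of [a]. *)
Definition growths m k x : nat := (\sum_(n1 <= i < m) fertile i k x).+1.

(** Legality of the steps is part of the event, so the estimates below hold for all [k] and [x] and
    not just almost surely. *)
Definition alive m k x : bool :=
  [&& x 0 == x0, all (fun i => x i.+1 \in nbrs (tree_at s T0 k x i.+1) (x i)) (iota 0 m),
      `[< tree_at s T0 k x n1 = T >], x n1 == a & all (fun i => x i != r) (iota n1 (m.+1 - n1))].

Lemma aliveS m k x : (n1 <= m)%N -> alive m.+1 k x =
  [&& alive m k x, x m.+1 \in nbrs (tree_at s T0 k x m.+1) (x m) & x m.+1 != r].
Proof.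
move=> hm; rewrite /alive.
have -> : iota 0 m.+1 = iota 0 m ++ [:: m] by rewrite -addn1 iotaD.
have -> : iota n1 (m.+2 - n1) = iota n1 (m.+1 - n1) ++ [:: m.+1].
  by rewrite (subSn (leqW hm)) -addn1 iotaD subnKC // leqW.
rewrite /alive !all_cat /= !andbT.
by rewrite -!andbA; do !bool_congr; rewrite [RHS]andbCA; do !bool_congr.
Qed.

Lemma alive_start k x : alive n1 k x = [&& x 0 == x0,
  all (fun i => x i.+1 \in nbrs (tree_at s T0 k x i.+1) (x i)) (iota 0 n1),
  `[< tree_at s T0 k x n1 = T >] & x n1 == a].
Proof.
rewrite /alive subSnn /= andbT; do 3 bool_congr.
by case: eqVneq => [->|].
Qed.

Lemma alive_walk m k x : alive m k x -> x 0 = x0 /\ walk s T0 k x m.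
Proof.
move=> /and5P[/eqP -> /allP h _ _ _]; split=> // i hi.
by apply: h; rewrite mem_iota.
Qed.

Lemma alive_neq m k x i : alive m k x -> (n1 <= i <= m)%N -> x i != r.
Proof.
move=> /and5P[_ _ _ _ /allP h] /andP[h1 h2]; apply: h; rewrite mem_iota h1 /=.
by rewrite subnKC ?ltnS // leqW // (leq_trans h1).
Qed.

Lemma alive_tree m k x : alive m k x -> bridged_tree r (tree_at s T0 k x m) /\
  (x m < nverts (tree_at s T0 k x m))%N.
Proof.
move=> /alive_walk[e0 hw]; have hx : (x 0 < nverts T0)%N by rewrite e0.
exact: (walk_treeP hT0 hx hw (leqnn m)).
Qed.

Lemma alive_color m k x col : alive m k x -> (n1 <= m)%N ->
  (forall u v, adj (tree_at s T0 k x m) u v -> u != v -> col u != col v) ->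
  col (x m) = col a (+) odd (m - n1).
Proof.
move=> am nm hcol; have [e0 hw] := alive_walk am.
have [[_ _ _ lr _] _] := alive_tree am.
have -> : a = x n1 by case/and5P: am => _ _ _ /eqP ->.
suff alt i : (n1 <= i <= m)%N -> col (x i) = col (x n1) (+) odd (i - n1).
  by apply: alt; rewrite nm leqnn.
move=> /andP[]; elim: i => [|i IH].
  by rewrite leqn0 => /eqP -> _; rewrite subnn addbF.
rewrite leq_eqVlt => /predU1P[<-|hi hi']; first by rewrite subnn addbF.
have ad : adj (tree_at s T0 k x m) (x i) (x i.+1).
  by apply: (adj_tree_mono hi'); have := hw _ hi'; rewrite mem_nbrs => /andP[].
have nri : x i != r by apply: (alive_neq am); apply/andP; split; [exact: hi|exact: ltnW].
have /(hcol _ _ ad) : x i != x i.+1.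
  by apply: contra nri => /eqP e; move: ad; rewrite -e lr.
rewrite (IH hi (ltnW hi')) subSn // oddS.
by case: (col (x i.+1)) (col (x n1)) (odd _) => [] [] [].
Qed.

Definition excursion_inv m k x := let G := tree_at s T0 k x m in
  [/\ harmonic_toward r a G (heights m k x) /\ heights m k x a = D, (a < nverts G)%N,
      fan a G, (growths m k x <= degree G a)%N & (1 < degree G a)%N].

Lemma harmonic_extend G y H' : r \in iota 0 (nverts G) ->
  harmonic_toward r a G H' -> harmonic_toward r a G (extend G y H').
Proof.
rewrite mem_iota => /= hr [Hr HH]; split=> [|u hu nur]; first by rewrite /extend hr.
by rewrite sum_extend HH // /extend hu.
Qed.

Lemma excursion_inv_start k x : alive n1 k x -> excursion_inv n1 k x.
Proof.
rewrite alive_start => /and4P[_ _ /asboolP eT _].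
have eH m : (m <= n1)%N -> heights m k x = H by case: m => //= m ->.
by rewrite /excursion_inv eT eH // /growths big_geq //; split=> //; rewrite ltnW.
Qed.

(** At a growth time the walker has the colour of [a], hence is not adjacent to it. So growth either
    adds leaves to [a] or leaves all neighbours of [a] untouched, and the fan persists. *)
Lemma excursion_inv_next m k x : (n1 <= m)%N -> alive m k x ->
  excursion_inv m k x -> excursion_inv m.+1 k x.
Proof.
move=> nm am; have [bTm hxm] := alive_tree am; have [gG _ hr _ _] := bTm.
rewrite /excursion_inv /= (ltnNge m n1) nm /= /growths big_nat_recr //= /fertile.
set G := tree_at s T0 k x m in bTm hxm gG hr *; move=> [[hHm Hma] ha fanG gr dG].
have ea : extend G (x m) (heights m k x) a = D by rewrite /extend ha.
case: ifP => [sm|_]; last first.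
  split=> //; last by rewrite addn0.
  by split=> //; apply: harmonic_extend => //; rewrite mem_iota.
have em : odd (m - n1) = false.
  rewrite oddB // (negbTE n1_even) addbF.
  by move: sm => /dvdnP[q ->]; rewrite oddM (negbTE s_even) andbF.
have [col hcol] := bridged_coloring bTm.
have ecol := alive_color am nm hcol; rewrite em addbF in ecol.
have [_ _ _ lr _] := bTm.
have nxa : ~~ adj G a (x m).
  apply/negP => ad; have [e|ne] := eqVneq a (x m).
    by move: ad; rewrite -e lr (negbTE nar).
  by have := hcol _ _ ad ne; rewrite ecol eqxx.
have nb : nbrs (attach G (x m) (k m)) a = nbrs G a ++ if a == x m then iota (nverts G) (k m) else [::].
  exact: nbrs_attach.
split.
- by split=> //; exact: harmonic_attach.
- exact: ltn_addr.
- have [p hp] := fanG; exists p => y; rewrite nb mem_cat => /orP[hy np|].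
    have hyN : (y < nverts G)%N by move: hy; rewrite mem_nbrs => /andP[].
    rewrite nbrs_attach // (hp _ hy np) ifN ?cats0 //.
    by apply: contra nxa => /eqP <-; move: hy; rewrite mem_nbrs => /andP[].
  case: eqVneq => // <-; rewrite mem_iota => hy _; exact: nbrs_attach_new.
- rewrite /degree nb size_cat -addSn leq_add // eq_sym.
  by case: eqVneq => //= _; rewrite size_iota; case: (k m).
- by rewrite /degree nb size_cat (leq_trans dG) // leq_addr.
Qed.

Lemma alive_inv m k x : (n1 <= m)%N -> alive m k x -> excursion_inv m k x.
Proof.
elim: m => [|m IH].
  by rewrite leqn0 => /eqP <-; exact: excursion_inv_start.
rewrite leq_eqVlt => /predU1P[<-|nm]; first exact: excursion_inv_start.
by rewrite aliveS // => /and3P[am _ _]; apply: excursion_inv_next => //; exact: IH.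
Qed.

Lemma heights_le m k x u : (heights m k x u <= D)%N.
Proof.
elim: m u => [|m IH] u //=; case: ifP => // _.
by rewrite /extend; case: ifP.
Qed.

Lemma growths_le m k x : (growths m k x <= m.+1)%N.
Proof.
rewrite /growths ltnS; apply: (@leq_trans (\sum_(n1 <= i < m) 1)).
  by apply: leq_sum => i _; case: (fertile _ _ _).
by rewrite sum_nat_const_nat muln1 leq_subr.
Qed.

Lemma adapted_heights m : adapted m m (heights m).
Proof.
elim: m => [//|m IH] k k' x x' hk hx /=.
have [hk' hx'] : (forall i, (i < m)%N -> k i = k' i) /\ (forall i, (i < m)%N -> x i = x' i).
  by split=> i hi; [apply: hk|apply: hx]; apply: leqW.
by rewrite (IH k k' x x') // (@adapted_tree s T0 m k k' x x') // hx.
Qed.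

Lemma adapted_fertile m : adapted m.+1 m.+1 (fertile m).
Proof. by move=> k k' x x' hk hx; rewrite /fertile hk // hx. Qed.

Lemma adapted_growths m : adapted m m (growths m).
Proof.
move=> k k' x x' hk hx; rewrite /growths; congr _.+1.
rewrite big_nat_cond [RHS]big_nat_cond; apply: eq_bigr => i /andP[/andP[_ hi] _].
congr nat_of_bool; apply: adapted_fertile => j hj; [apply: hk|apply: hx]; exact: leq_trans hi.
Qed.

Lemma adapted_alive m : (n1 <= m)%N -> adapted m m.+1 (alive m).
Proof.
move=> nm k k' x x' hk hx; rewrite /alive !hx //.
rewrite (@adapted_tree s T0 n1 k k' x x'); last 2 first.
- by move=> i hi; apply: hk; apply: leq_trans nm.
- by move=> i hi; apply: hx; apply: leq_trans (leqW nm).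
congr [&& _, _, _, _ & _].
  apply: eq_in_all => i; rewrite mem_iota leq0n add0n andTb => hi.
  rewrite (hx i.+1 hi) (hx i (ltnW hi)) (@adapted_tree s T0 i.+1 k k' x x') // => j hj.
    by apply: hk; apply: leq_trans hi.
  by apply: hx; apply: leq_trans (leqW hi).
apply: eq_in_all => i; rewrite mem_iota subnKC; last exact: leqW.
by move=> /andP[_ hi]; rewrite hx.
Qed.

Variable R : realType.

Definition potential m k x : R :=
  (alive m k x)%:R * (heights m k x (x m))%:R * (growths m k x)%:R.

Definition visit m k x : bool := alive m k x && (x m == a).

Lemma adapted_potential m : (n1 <= m)%N -> adapted m m.+1 (potential m).
Proof.
move=> nm k k' x x' hk hx; rewrite /potential (adapted_alive nm hk hx) hx //.
have hx' i : (i < m)%N -> x i = x' i by move=> hi; apply: hx; apply: leqW.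
by rewrite (adapted_heights hk hx') (adapted_growths hk hx').
Qed.

Lemma adapted_visit m : (n1 <= m)%N -> adapted m m.+1 (visit m).
Proof. by move=> nm k k' x x' hk hx; rewrite /visit (adapted_alive nm hk hx) hx. Qed.

Lemma potential_ge0 m k x : 0 <= potential m k x.
Proof. by rewrite /potential !mulr_ge0. Qed.

Lemma potential_le m k x : potential m k x <= (D * m.+1)%:R * (alive m k x)%:R.
Proof.
rewrite /potential -mulrA mulrC ler_wpM2r // -natrM ler_nat leq_mul //.
  exact: heights_le.
exact: growths_le.
Qed.

Lemma update_lt (x : nat -> nat) m y i : (i < m)%N -> x i = update x m y i.
Proof. by move=> hi; rewrite /update ltn_eqF. Qed.

Lemma alive_update m k x y : (n1 <= m)%N -> alive m.+1 k (update x m.+1 y) =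
  [&& alive m k x, y \in nbrs (tree_at s T0 k x m.+1) (x m) & y != r].
Proof.
move=> nm; rewrite aliveS // -(@adapted_alive _ nm k k x _ (fun _ _ => erefl)); last first.
  by move=> i hi; exact: update_lt.
rewrite -(@adapted_tree s T0 m.+1 k k x _ (fun _ _ => erefl)); last first.
  by move=> i hi; exact: update_lt.
by rewrite /update eqxx (ltn_eqF (ltnSn m)).
Qed.

(** Off [a] the mean height is preserved, and killing at [r] is free since the height there is 0. At
    [a] the mean height drops by the inverse degree; multiplied by the number of growths, at most
    the degree, this costs at most 1. A fertile time raises that number by one and gains [D]. *)
Lemma potential_step m k x : (n1 <= m)%N ->
  potential m k x + ((s %| m)%N && (0 < k m)%N)%:R * D%:R * (visit m k x)%:R <=
  step_mean s T0 m (potential m.+1) k x + (visit m k x)%:R.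
Proof.
move=> nm; rewrite /potential /visit; case: (boolP (alive m k x)) => [am|_]; last first.
  by rewrite !mul0r mulr0 !addr0; apply: step_mean_ge0 => ? ?; rewrite !mulr_ge0.
rewrite mul1r /=.
have [bTm hxm] := alive_tree am.
have [[hHm Hma] ha _ _ _] := alive_inv nm am.
have [[hHm' _] ha' _ gr' dG'] := excursion_inv_next nm am (alive_inv nm am).
set G := tree_at s T0 k x m.+1 in hHm' ha' gr' dG' *.
have hxG : (x m < nverts G)%N by apply: leq_trans hxm _; exact: nverts_tree_mono.
have xr : x m != r by apply: (alive_neq am); rewrite nm leqnn.
have Hx : heights m.+1 k x (x m) = heights m k x (x m).
  by rewrite /= ltnNge nm /= /extend hxm.
have Gx : growths m.+1 k x = (growths m k x + fertile m k x)%N.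
  by rewrite /growths big_nat_recr //= addSn.
set h := heights m.+1 k x in hHm' Hx *; set gg := growths m.+1 k x in gr' Gx *.
have dpos : (0 < degree G (x m))%N.
  have [_ /(_ (x m) hxG xr)] := hHm'; case: eqVneq => [->|_] e; last first.
    have [bG cG hr lr _] : bridged_tree r G.
      have [e0 hw] := alive_walk am; have hx : (x 0 < nverts T0)%N by rewrite e0.
      exact: (walk_tree_next hT0 hx hw).
    have [[|y p] /= pp lp] := cG _ _ hxG hr; first by rewrite lp eqxx in xr.
    move: pp => /andP[ad _]; rewrite /degree -has_predT; apply/hasP; exists y => //.
    by rewrite nbrs_adj.
  exact: ltnW.
have -> : step_mean s T0 m (fun k x => (alive m.+1 k x)%:R *
      (heights m.+1 k x (x m.+1))%:R * (growths m.+1 k x)%:R) k x =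
    gg%:R * (\sum_(y <- nbrs G (x m)) h y)%N%:R / (degree G (x m))%:R :> R.
  rewrite /step_mean natr_sum mulr_sumr; congr (_ / _).
  rewrite big_seq [RHS]big_seq; apply: eq_bigr => y hy.
  have up i : (i < m.+1)%N -> x i = update x m.+1 y i by exact: update_lt.
  rewrite -(@adapted_heights m.+1 k k x _ (fun _ _ => erefl) up).
  rewrite -(@adapted_growths m.+1 k k x _ (fun _ _ => erefl) up).
  rewrite alive_update // am hy /= -/h -/gg {1}/update eqxx.
  case: eqVneq => [->|_] /=; last by rewrite mul1r mulrC.
  by have [-> _] := hHm'; rewrite !mul0r mulr0.
have [_ /(_ (x m) hxG xr) sumH] := hHm'.
have -> : (\sum_(y <- nbrs G (x m)) h y)%N%:R =
    (degree G (x m))%:R * (h (x m))%:R - (x m == a)%:R :> R.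
  by rewrite -natrM -sumH natrD addrK.
have -> : gg%:R * ((degree G (x m))%:R * (h (x m))%:R - (x m == a)%:R) / (degree G (x m))%:R =
    gg%:R * (h (x m))%:R - gg%:R * ((x m == a)%:R / (degree G (x m))%:R) :> R.
  by field; rewrite pnatr_eq0 -lt0n.
rewrite Hx.
have loss : gg%:R * ((x m == a)%:R / (degree G (x m))%:R) <= (x m == a)%:R :> R.
  case: eqVneq => [->|_]; last by rewrite mul0r mulr0.
  by rewrite mul1r ler_pdivrMr ?ltr0n ?(ltnW dG') // mul1r ler_nat.
have gain : (heights m k x (x m))%:R * (growths m k x)%:R +
    ((s %| m)%N && (0 < k m)%N)%:R * D%:R * (x m == a)%:R =
    gg%:R * (heights m k x (x m))%:R :> R.
  rewrite Gx natrD mulrDl mulrC; congr (_ + _); rewrite /fertile.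
  case: eqVneq => [->|_] /=; last by rewrite andbF mulr0 mul0r.
  by rewrite Hma mulr1.
by rewrite gain; move: loss; lra.
Qed.

Lemma visit_odd m k x : (n1 <= m)%N -> odd m -> visit m k x = false.
Proof.
move=> nm om; apply/negP => /andP[am /eqP xa].
have [bTm _] := alive_tree am; have [col hcol] := bridged_coloring bTm.
have := alive_color am nm hcol; rewrite xa oddB // om (negbTE n1_even).
by case: (col a).
Qed.

(** At least half of the neighbours of [a] are leaves, as its degree is at least 2 and the fan
    allows one exception. Time [m.+1] is odd, so nothing grows at the leaf and the return to [a] is
    forced. *)
Lemma visit_return m k x : (n1 <= m)%N -> ~~ odd m ->
  (visit m k x)%:R / 2 <= step_mean s T0 m (step_mean s T0 m.+1
    (fun k x => (visit m.+2 k x)%:R : R)) k x.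
Proof.
move=> nm em; case: (boolP (visit m k x)) => [|_]; last by rewrite mul0r; do 2![apply: step_mean_ge0 => ? ?].
rewrite mul1r => /andP[am /eqP xa].
have [bTm hxm] := alive_tree am.
have [_ ha' [p hp] _ dG] := excursion_inv_next nm am (alive_inv nm am).
have [e0 hw] := alive_walk am; have hx : (x 0 < nverts T0)%N by rewrite e0.
have [gG _ hr lr _] := walk_tree_next hT0 hx hw.
set G := tree_at s T0 k x m.+1 in ha' hp dG gG hr lr *.
apply: (@le_trans _ _ ((\sum_(y <- nbrs G a) (y != p)%:R) / (degree G a)%:R)).
  have -> : \sum_(y <- nbrs G a) (y != p)%:R = (degree G a)%:R - (p \in nbrs G a)%:R :> R.
    rewrite -(sum_pred1_uniq R p (uniq_nbrs G a)) /degree -[X in X%:R - _]sum1_size natr_sum -sumrB.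
    by apply: eq_bigr => y _; case: (y == p); rewrite ?subrr ?subr0.
  rewrite ler_pdivlMr ?ltr0n ?(ltnW dG) //.
  have : 2 <= (degree G a)%:R :> R by rewrite ler_nat.
  by case: (p \in _) => /=; lra.
rewrite {1}/step_mean xa -/G ler_wpM2r ?invr_ge0 // big_seq [leRHS]big_seq.
apply: ler_sum => y hy; case: eqVneq => [_|np] /=; first by apply: step_mean_ge0.
have nby : nbrs G y = [:: a] by exact: hp.
have nyr : y != r.
  apply/eqP => er; have : r \in nbrs G r by rewrite nbrs_adj // lr.
  by rewrite -{2}er nby inE eq_sym (negbTE nar).
have tE : tree_at s T0 k (update x m.+1 y) m.+2 = G.
  rewrite [LHS]/= ifF; last first.
    apply/negP => /dvdnP[q eq]; have := congr1 odd eq.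
    by rewrite oddS oddM (negbTE em) (negbTE s_even) andbF.
  rewrite -/(tree_at s T0 k (update x m.+1 y) m.+1).
  rewrite -(@adapted_tree s T0 m.+1 k k x _ (fun _ _ => erefl)) //.
  by move=> i hi; exact: update_lt.
have xy : update x m.+1 y m.+1 = y by rewrite /update eqxx.
have nm1 : (n1 <= m.+1)%N by exact: leqW.
have -> : step_mean s T0 m.+1 (fun k x => (visit m.+2 k x)%:R) k (update x m.+1 y) =
    (visit m.+2 k (update (update x m.+1 y) m.+2 a))%:R :> R.
  by rewrite /step_mean tE xy /degree nby big_seq1 divr1.
rewrite /visit alive_update // tE xy nby inE eqxx nar alive_update // am xa hy nyr.
by rewrite {1}/update !eqxx.
Qed.

End Excursion.

(** A block ends two steps after a growth time. Since [v] at most halves every two steps, all losses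
    before the growth time of a block are bounded by a multiple of [v] at that time, and the gain
    [K] there outweighs them. *)
Lemma potential_blocks (R : realFieldType) (s q : nat) (K : R) (p v : nat -> R) :
  (0 < s)%N -> ~~ odd s -> 2 ^+ s.+1 <= K -> (forall m, 0 <= v m) ->
  (forall m, ((s * q).+2 <= m)%N -> p m <= p m.+1 + v m) ->
  (forall m, ((s * q).+2 <= m)%N -> (s %| m)%N -> p m + K * v m <= p m.+1 + v m) ->
  (forall m, ((s * q).+2 <= m)%N -> ~~ odd m -> v m <= v m.+2 + v m.+2) ->
  (forall m, ((s * q).+2 <= m)%N -> odd m -> v m = 0) ->
  forall j, (q <= j)%N -> p (s * q).+2 <= p (s * j).+2.
Proof.
move=> s0 s_even hK v0 loss gain double odd0 j; elim: j => [|j IH].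
  by rewrite leqn0 => /eqP ->.
rewrite leq_eqVlt => /predU1P[<- //|qj]; apply: le_trans (IH qj) _.
set m := (s * j).+2; have hm : ((s * q).+2 <= m)%N by rewrite !ltnS leq_mul.
have em : ~~ odd m by rewrite /= negbK oddM (negbTE s_even).
(* The factor is the geometric sum 2 + 4 + ... + 2^i. *)
have claim i : p m <= p (m + i.*2)%N + 2 * (2 ^+ i - 1) * v (m + i.*2)%N.
  elim: i => [|i IHi]; first by rewrite addn0 expr0 subrr mulr0 mul0r addr0.
  have hmi : ((s * q).+2 <= m + i.*2)%N by rewrite (leq_trans hm) // leq_addr.
  have emi : ~~ odd (m + i.*2) by rewrite oddD odd_double addbF.
  have l1 := loss _ hmi; have l2 := loss _ (leqW hmi).
  have l3 := odd0 _ (leqW hmi); have l4 := double _ hmi emi.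
  rewrite doubleS !addnS exprS.
  have e1 : 1 <= (2 : R) ^+ i by rewrite exprn_ege1 // ler1n.
  move: (v0 (m + i.*2)) IHi l1 l2 l4; rewrite l3 ?oddS //.
  move: (2 ^+ i) (p (m + i.*2)%N) (p (m + i.*2).+1) (p (m + i.*2).+2) (v (m + i.*2)%N)
    (v (m + i.*2).+2) e1 => e a1 a2 a3 b1 b2 e1 h0 h1 h2 h3 h4.
  have : (2 * e - 1) * b1 <= (2 * e - 1) * (b2 + b2) by rewrite ler_wpM2l //; lra.
  by lra.
have [i [im is']] : exists i, (m + i.*2 = s * j.+1)%N /\ (i <= s)%N.
  exists (s./2).-1; move: s0 s_even; rewrite /m mulnS; case: (s) => [//|[//|s']] _ /=.
  rewrite !negbK => es; split; last first.
    by rewrite -divn2 (leq_trans (leq_div _ _)) // !leqW.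
  by rewrite halfK (negbTE es) subn0 [RHS]addnC !addnS !addSn.
(* Here [i] is [s./2 - 1], the number of double steps from the start of the block to its growth
   time. *)
have := claim i; rewrite im => cl.
have hM : ((s * q).+2 <= s * j.+1)%N by rewrite -im (leq_trans hm) // leq_addr.
have g1 := gain _ hM (dvdn_mulr _ (dvdnn s)); have l2 := loss _ (leqW hM).
have o2 : v (s * j.+1).+1 = 0 by apply: odd0; [exact: leqW|rewrite /= oddM (negbTE s_even)].
apply: le_trans cl _.
have : (2 * (2 ^+ i - 1) + 1) * v (s * j.+1)%N <= K * v (s * j.+1)%N.
  rewrite ler_wpM2r //; apply: le_trans hK.
  have : (2 : R) ^+ i <= 2 ^+ s by rewrite ler_weXn2l // ler1n.
  by rewrite exprS; lra.
by move: g1 l2; rewrite o2; lra.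
Qed.

(** * Hitting times and integrals of path functions *)

Section HittingTime.
Context (R : realType) (d : measure_display) (Omega : measurableType d).
Context (P : probability Omega R).
Variables (xi X : nat -> {RV P >-> nat}).

Lemma hitting_time_ge n z N w : (forall i, (n < i <= n + N)%N -> X i w != z) ->
  ((N.+1%:R)%:E <= hitting_time X n z w)%E.
Proof.
move=> h; apply: le_ereal_inf_tmp => _ [m /= [m1 Xm] <-]; rewrite lee_fin ler_nat ltnNge.
apply/negP => mN; have := h (n + m)%N; rewrite Xm eqxx leq_add2l mN -{1}[n]addn0 ltn_add2l m1.
by move=> /(_ isT).
Qed.

Lemma hitting_time_ge0 n z w : (0 <= hitting_time X n z w)%E.
Proof. by apply: le_ereal_inf_tmp => _ [m _ <-]; rewrite lee_fin. Qed.

Lemma measurable_hitting_time n z : measurable_fun setT (hitting_time X n z).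
Proof.
pose h m w : \bar R := if (1 <= m)%N && (X (n + m)%N w == z) then (m%:R)%:E else +oo%E.
have mh m : measurable_fun setT (h m).
  apply: (@measurable_adapted _ _ _ _ xi X 0 (n + m).+1 _ _
    (fun _ x => if (1 <= m)%N && (x (n + m)%N == z) then (m%:R)%:E else +oo%E)).
  by move=> k k' x x' _ hx; rewrite hx.
have -> : hitting_time X n z = (fun w => einfs (h^~ w) 0).
  apply/funext => w; apply/eqP; rewrite eq_le; apply/andP; split.
    apply: le_ereal_inf_tmp => _ [m _ <-]; rewrite /h.
    case: ifP => [/andP[m1 /eqP Xm]|_]; last by rewrite leey.
    by apply: ereal_inf_lbound; exists m.
  apply: le_ereal_inf_tmp => _ [m /= [m1 Xm] <-]; apply: ereal_inf_lbound.
  by exists m => //; rewrite /h m1 Xm eqxx.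
exact: measurable_fun_einfs.
Qed.

End HittingTime.

(** Comparison with the harmonic series, since the denominator is at most [C.+1 * m.+1]. *)
Lemma inverse_linear_unbounded (R : realType) (n : nat) (b : R) (C : nat) : 0 < b ->
  unbounded_sum n (fun m => b / (C + C * m).+1%:R).
Proof.
move=> b0.
have hu : unbounded_sum 0 (@harmonic R).
  move=> K; apply: contrapT => h; apply: (@dvg_harmonic R).
  apply: nondecreasing_is_cvgn.
    by apply: nondecreasing_series => i _ _; rewrite /harmonic invr_ge0.
  exists K => _ [N _ <-]; rewrite /series /= leNgt; apply/negP => hK.
  by apply: h; exists N; rewrite ltW.
have a0 : 0 < b / C.+1%:R by rewrite divr_gt0 ?ltr0n.
apply: unbounded_sum_le (unbounded_sumZ a0 (unbounded_sum_tail (leq0n n) hu)) => m _.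
rewrite /harmonic -mulrA -invfM ler_pM2l // lef_pV2 ?posrE ?mulr_gt0 ?ltr0n //.
by rewrite -natrM ler_nat mulSn mulnS addSn ltnS leq_addl.
Qed.

Section PathIntegrals.
Context (R : realType) (d : measure_display) (Omega : measurableType d).
Context (P : probability Omega R).
Variables (xi X : nat -> {RV P >-> nat}).

Local Notation path f w := (f (fun i => xi i w) (fun i => X i w)).
Local Notation E f := (\int[P]_w (path f w)%:E)%E.

Lemma integral_path_fin a b (f : (nat -> nat) -> (nat -> nat) -> R) (K : R) :
  adapted a b f -> (forall k x, 0 <= f k x <= K) -> E f \is a fin_num.
Proof.
move=> hf f0K; rewrite ge0_fin_numE; last first.
  by apply: integral_ge0 => w _; rewrite lee_fin; case/andP: (f0K (fun i => xi i w) (fun i => X i w)).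
apply: (@le_lt_trans _ _ (\int[P]_w (K%:E))%E).
  apply: ge0_le_integral => //.
  - by move=> w _; rewrite lee_fin; case/andP: (f0K (fun i => xi i w) (fun i => X i w)).
  - by apply/measurable_EFinP; exact: measurable_adapted hf.
  - by move=> w _; rewrite lee_fin; case/andP: (f0K (fun i => xi i w) (fun i => X i w)).
by rewrite integral_cst // ltey_eq fin_numM // fin_num_measure.
Qed.

Lemma integral_path_le2 a b (f1 f2 f3 f4 : (nat -> nat) -> (nat -> nat) -> R) :
  adapted a b f1 -> adapted a b f2 -> adapted a b f3 -> adapted a b f4 ->
  (forall k x, 0 <= f1 k x) -> (forall k x, 0 <= f2 k x) ->
  (forall k x, 0 <= f3 k x) -> (forall k x, 0 <= f4 k x) ->
  (forall k x, f1 k x + f2 k x <= f3 k x + f4 k x) -> (E f1 + E f2 <= E f3 + E f4)%E.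
Proof.
move=> h1 h2 h3 h4 p1 p2 p3 p4 le.
have m (f : (nat -> nat) -> (nat -> nat) -> R) : adapted a b f ->
    measurable_fun setT (fun w => (path f w)%:E).
  by move=> hf; apply/measurable_EFinP; exact: measurable_adapted hf.
rewrite -!ge0_integralD //; try by [move=> w _; rewrite lee_fin|exact: m].
apply: ge0_le_integral => //.
- by move=> w _; rewrite lee_fin addr_ge0.
- by apply: emeasurable_funD; exact: m.
- by apply: emeasurable_funD; exact: m.
- by move=> w _; rewrite lee_fin.
Qed.

End PathIntegrals.

(** * Infinite mean hitting time of the root *)

Section NotPositive.
Context (R : realType) (d : measure_display) (Omega : measurableType d).
Context (P : probability Omega R).
Variables (s : nat) (T0 : graph) (x0 r : nat) (xi X : nat -> {RV P >-> nat}).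
Hypotheses (hindep : mutually_independent xi) (hX : is_TBRW s T0 x0 xi X).
Hypotheses (s0 : (0 < s)%N) (s_even : ~~ odd s).
Hypotheses (hT0 : bridged_tree r T0) (hx0 : (x0 < nverts T0)%N).
Variables (kappa : R).
Hypotheses (hkappa : 0 < kappa).
Hypothesis env_pos : forall m, (kappa%:E <= P (xi m @^-1` [set j | (0 < j)%N]))%E.

Local Notation path f w := (f (fun i => xi i w) (fun i => X i w)).
Local Notation E f := (\int[P]_w (path f w)%:E)%E.

(** Supplies the environment in which the deep vertex is reached; by independence each of its finite
    stretches has positive probability. *)
Lemma positive_env : exists k : nat -> nat,
  (forall i, (0 < k i)%N) /\ forall i, (0 < P (xi i @^-1` [set k i]))%E.
Proof.
have /choice[k hk] : forall i, exists j, (0 < j)%N /\ (0 < P (xi i @^-1` [set j]))%E.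
  move=> i; apply: contrapT => h.
  have : P (xi i @^-1` [set j | (0 < j)%N]) = 0%E.
    have -> : xi i @^-1` [set j | (0 < j)%N] = \bigcup_(j in [set j | (0 < j)%N]) (xi i @^-1` [set j]).
      by apply/seteqP; split=> w /=; [move=> hw; exists (xi i w)|move=> [j /= hj ->]].
    rewrite measure_bigcup; last 2 first.
    - by move=> j _; exact: measurable_RV_preimage.
    - by move=> j1 j2 _ _ [w [/= <- <-]].
    rewrite eseries0 // => j _ /set_mem /= j0; apply/eqP; rewrite eq_le measure_ge0 andbT.
    by rewrite leNgt; apply/negP => hj; apply: h; exists j.
  move=> e; have := env_pos i; rewrite e lee_fin leNgt hkappa //.
by exists k; split=> i; case: (hk i).
Qed.

Lemma prob_env_gt0 k m : (forall i, (0 < P (xi i @^-1` [set k i]))%E) ->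
  (0 < P (fiber xi X m 0 k k))%E.
Proof.
move=> kpos; elim: m => [|m IH].
  have -> : fiber xi X 0 0 k k = setT by apply/seteqP.
  by rewrite probability_setT lte_fin.
have -> : fiber xi X m.+1 0 k k = fiber xi X m 0 k k `&` xi m @^-1` [set k m].
  apply/seteqP; split=> w /=.
    by move=> [h _]; split; [split=> // i hi; apply: h; apply: leqW|apply: h].
  move=> [[h _] hm]; split=> // i; rewrite ltnS leq_eqVlt => /predU1P[-> //|]; exact: h.
by rewrite prob_env_next // mule_gt0.
Qed.

Lemma prob_reach_gt0 k n x : (forall i, (0 < P (xi i @^-1` [set k i]))%E) ->
  x 0 = x0 -> walk s T0 k x n -> (0 < P (fiber xi X n n.+1 k x))%E.
Proof.
move=> kpos e0 hw; rewrite (prob_fiber hX) // mule_gt0 //.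
  have -> : fiber xi X n 0 k x = fiber xi X n 0 k k by apply/seteqP; split=> w [h _]; split.
  exact: prob_env_gt0.
rewrite lte_fin /path_weight e0 eqxx mul1r prodr_gt0 // => i _.
have := hw i (ltn_ord i); rewrite /step_prob => hi; rewrite hi divr_gt0 // ltr0n.
by rewrite /degree; case: (nbrs _ _) hi.
Qed.

Section Excursion.
Variables (q : nat) (T : graph) (a D : nat) (H : nat -> nat).
Let n1 := (s * q).+2.
Hypotheses (bT : bridged_tree r T) (haT : (a < nverts T)%N) (nar : a != r).
Hypotheses (hH : harmonic_toward r a T H) (Ha : H a = D) (HD : forall u, (H u <= D)%N).
Hypotheses (fanT : fan a T) (degT : (1 < degree T a)%N).
Hypothesis (D_large : 2 ^+ s.+1 <= kappa * D%:R).
Hypothesis start_gt0 : (0 < P [set w | path (alive s T0 x0 r n1 T a n1) w])%E.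

Local Notation alive := (alive s T0 x0 r n1 T a).
Local Notation potential := (potential s T0 x0 r n1 T a H R).
Local Notation visit := (visit s T0 x0 r n1 T a).

Let n1_even : ~~ odd n1.
Proof. by rewrite /= negbK oddM (negbTE s_even). Qed.

Let visitR m k x : R := (visit m k x)%:R.

Let aV m : (n1 <= m)%N -> adapted m m.+1 (visitR m).
Proof. by move=> nm k k' x x' hk hx; rewrite /visitR (adapted_visit _ _ _ _ _ _ nm hk hx). Qed.

Let aP m : (n1 <= m)%N -> adapted m m.+1 (potential m).
Proof. exact: adapted_potential. Qed.

Let visitR_ge0 m k x : 0 <= visitR m k x. Proof. by []. Qed.

Let finV m : (n1 <= m)%N -> E (visitR m) \is a fin_num.
Proof.
move=> nm; apply: (integral_path_fin (K := 1) xi X (aV nm)) => k x.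
by rewrite /visitR; case: (visit m k x); rewrite ?ler01 lexx.
Qed.

Let finP m : (n1 <= m)%N -> E (potential m) \is a fin_num.
Proof.
move=> nm; apply: (integral_path_fin (K := (D * m.+1)%:R) xi X (aP nm)) => k x.
rewrite potential_ge0 /=; apply: le_trans (potential_le s T0 x0 r n1 T a HD R m k x) _.
by rewrite ler_piMr // lern1; case: (alive m k x).
Qed.

(** The mean of [potential_step]. At growth times [xi m] is independent of the visit to [a] and
    positive with probability at least [kappa], so the gain [D] becomes [kappa * D]. *)
Lemma expect_potential_step m : (n1 <= m)%N ->
  (E (potential m) + (if (s %| m)%N then (kappa * D%:R)%:E else 0%E) * E (visitR m)
    <= E (potential m.+1) + E (visitR m))%E.
Proof.
move=> nm; pose F (k x : nat -> nat) : R := ((s %| m)%N && (0 < k m)%N)%:R * D%:R * visitR m k x.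
have F0 k x : 0 <= F k x by rewrite /F !mulr_ge0.
have aF : adapted m.+1 m.+1 F.
  move=> k k' x x' hk hx; rewrite /F hk // (@aV m nm k k' x x') // => i hi.
  by apply: hk; apply: leqW.
apply: (@le_trans _ _ (E (potential m) + E F)%E).
  rewrite leeD2l //; case: ifP => sm; last first.
    by rewrite mul0e; apply: integral_ge0 => w _; rewrite lee_fin.
  set B := [set j | (0 < j)%N].
  have mB : measurable (xi m @^-1` B) by exact: measurable_RV_preimage.
  have -> : E F = (D%:R%:E * \int[P]_(w in xi m @^-1` B) (path (visitR m) w)%:E)%E.
    rewrite [X in (_ * X)%E]integral_mkcond -ge0_integralZl_EFin //; last 2 first.
    - by move=> w _; rewrite patchE; case: ifP => _; rewrite ?lee_fin.
    - apply/(measurable_restrictT _ _).1 => //; apply: measurable_funTS.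
      by apply/measurable_EFinP; exact: measurable_adapted (aV nm).
    apply: eq_integral => w _; rewrite patchE /F sm /=.
    case: (boolP (0 < xi m w)%N) => hw; first by rewrite mem_set // mul1r EFinM.
    by rewrite memNset ?mule0 ?mul0r //; apply/negP.
  rewrite (integral_path_env hindep hX B (aV nm)) // muleA lee_wpmul2r //.
    by apply: integral_ge0 => w _; rewrite lee_fin.
  by rewrite mulrC EFinM lee_wpmul2l // lee_fin.
rewrite [X in (_ <= X + _)%E](integral_path_step hX (ltnSn m) (f := potential m.+1)); last 2 first.
- by apply: adaptedW (aP (leqW nm)).
- by move=> k x; exact: potential_ge0.
apply: (@integral_path_le2 _ _ _ P xi X m.+1 m.+1) => //.
- by apply: adaptedW (aP nm).
- by apply: adapted_step_mean => //; apply: adaptedW (aP (leqW nm)).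
- by apply: adaptedW (aV nm).
- by move=> k x; exact: potential_ge0.
- by move=> k x; apply: step_mean_ge0 => ? ?; exact: potential_ge0.
- by move=> k x; apply: (@potential_step s T0 x0 r s_even hT0 hx0 n1 T a D H).
Qed.

Lemma expect_visit_return m : (n1 <= m)%N -> ~~ odd m ->
  (E (visitR m) <= E (visitR m.+2) + E (visitR m.+2))%E.
Proof.
move=> nm em.
have nm2 : (n1 <= m.+2)%N by rewrite !leqW.
have aV2 : adapted m.+2 m.+3 (visitR m.+2) by exact: aV.
have aV1 : adapted m.+2 m.+2 (step_mean s T0 m.+1 (visitR m.+2)).
  by apply: adapted_step_mean => //; exact: aV2.
have aV0 : adapted m.+2 m.+1 (step_mean s T0 m (step_mean s T0 m.+1 (visitR m.+2))).
  by apply: adapted_step_mean => //; exact: aV1.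
have m2 k x : 0 <= step_mean s T0 m.+1 (visitR m.+2) k x by exact: step_mean_ge0.
have m1 k x : 0 <= step_mean s T0 m (step_mean s T0 m.+1 (visitR m.+2)) k x.
  exact: step_mean_ge0.
rewrite (integral_path_step hX (ltnSn m.+1) (f := visitR m.+2)) //.
rewrite (integral_path_step hX _ (f := step_mean s T0 m.+1 (visitR m.+2)) aV1) //.
rewrite -[leLHS]adde0 -(@integral0 _ _ _ P setT).
apply: (@integral_path_le2 _ _ _ P xi X m.+2 m.+1 _ (fun _ _ => 0)) => //.
- by apply: adaptedW (aV nm) => //; exact: leqW.
- move=> k x; rewrite addr0.
  have := @visit_return s T0 x0 r s_even hT0 hx0 n1 T a D H n1_even haT nar hH Ha
    fanT degT R m k x nm em.
  by rewrite -/(visitR m k x) -/(visitR m.+2); lra.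
Qed.

Lemma alive_mono m N k x : (n1 <= m <= N)%N -> alive N k x -> alive m k x.
Proof.
move=> /andP[nm]; elim: N => [|N IH]; first by rewrite leqn0 => /eqP ->.
rewrite leq_eqVlt => /predU1P[-> //|mN]; rewrite aliveS ?(leq_trans nm) //.
by move=> /and3P[h _ _]; exact: IH.
Qed.

Let measurable_alive m : (n1 <= m)%N -> measurable [set w | path (alive m) w].
Proof.
by move=> nm; apply: (measurable_path_bool xi X (adapted_alive s T0 x0 r T a nm)).
Qed.

Let aA m : (n1 <= m)%N -> adapted m m.+1 (fun k x => (alive m k x)%:R : R).
Proof.
by move=> nm k k' x x' hk hx; rewrite (adapted_alive s T0 x0 r T a nm hk hx).
Qed.

Let A m := fine (P [set w | path (alive m) w]).

Let AE m : (n1 <= m)%N -> P [set w | path (alive m) w] = (A m)%:E.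
Proof. by move=> nm; rewrite fineK // fin_num_measure //; exact: measurable_alive. Qed.

(** At time [n1] the potential is [D] on the event [alive]; at time m it is at most [D * m.+1]
    there. Between the two its mean does not decrease, and [D] cancels. *)
Lemma expect_potential_bound j : (q <= j)%N ->
  A n1 <= (s * j).+3%:R * A (s * j).+2.
Proof.
move=> qj; pose p m := fine (E (potential m)); pose v m := fine (E (visitR m)).
have pE m : (n1 <= m)%N -> E (potential m) = (p m)%:E by move=> nm; rewrite fineK // finP.
have vE m : (n1 <= m)%N -> E (visitR m) = (v m)%:E by move=> nm; rewrite fineK // finV.
have D0 : 0 < D%:R :> R.
  by rewrite -(pmulr_rgt0 _ hkappa) (lt_le_trans _ D_large) // exprn_gt0.
have nj : (n1 <= (s * j).+2)%N by rewrite !ltnS leq_mul.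
have start : p n1 = D%:R * A n1.
  rewrite /p /A -(integral_path_bool xi X (adapted_alive s T0 x0 r T a (leqnn n1))).
  rewrite -[RHS]/(fine (D%:R)%:E * _) -fineM //; last first.
    apply: (integral_path_fin (K := 1) xi X (aA (leqnn n1))) => k x.
    by case: (alive n1 k x); rewrite ?ler01 lexx.
  rewrite -ge0_integralZl_EFin //.
  - congr fine; apply: eq_integral => w _; rewrite -EFinM /potential /growths big_geq // mulr1.
    case: (boolP (alive n1 _ _)) => [al|_]; last by rewrite mul0r mulr0.
    have [[_ Hma] _ _ _ _] := @alive_inv s T0 x0 r s_even hT0 hx0 n1 T a D H n1_even haT nar hH Ha fanT degT n1 _ _ (leqnn n1) al.
    rewrite mul1r mulr1; congr (_%:R%:E); rewrite -Hma; congr (heights _ _ _ _ _ _ _).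
    by move: al; rewrite alive_start // => /and4P[_ _ _ /eqP].
  - apply/measurable_EFinP; exact: measurable_adapted (aA (leqnn n1)).
have last_ : p (s * j).+2 <= (D * (s * j).+3)%:R * A (s * j).+2.
  set m := (s * j).+2 in nj *.
  rewrite -lee_fin -pE // EFinM -AE //.
  rewrite -(integral_path_bool xi X (adapted_alive s T0 x0 r T a nj)).
  rewrite -ge0_integralZl_EFin //; last first.
    by apply/measurable_EFinP; exact: measurable_adapted (aA nj).
  apply: ge0_le_integral => //.
  - by move=> w _; rewrite lee_fin potential_ge0.
  - by apply/measurable_EFinP; exact: measurable_adapted (aP nj).
  - by apply: measurable_funeM; apply/measurable_EFinP; exact: measurable_adapted (aA nj).
  - by move=> w _; rewrite -EFinM lee_fin; exact: potential_le.
rewrite -(ler_pM2l D0) -start mulrA -natrM; apply: le_trans last_.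
apply: (@potential_blocks R s q (kappa * D%:R) p v) => //.
- by move=> m; rewrite fine_ge0 // integral_ge0 // => w _; rewrite lee_fin.
- move=> m nm; have := expect_potential_step nm.
  rewrite !pE ?leqW // !vE //; case: ifP => _; rewrite -?EFinM -?EFinD.
    rewrite lee_fin; apply: le_trans; rewrite lerDl mulr_ge0 ?mulr_ge0 ?(ltW hkappa) //.
    by rewrite fine_ge0 // integral_ge0 // => w _; rewrite lee_fin.
  by rewrite lee_fin mul0r addr0.
- move=> m nm sm; have := expect_potential_step nm.
  by rewrite sm !pE ?leqW // !vE // -EFinM -!EFinD lee_fin.
- move=> m nm em; have := expect_visit_return nm em.
  by rewrite !vE ?leqW // -EFinD lee_fin.
- move=> m nm om; rewrite /v (_ : E (visitR m) = 0%E) //.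
  rewrite (_ : (fun w => _) = cst 0%E) ?integral0 //; apply/funext => w.
  by rewrite /visitR (visit_odd s hT0 hx0 T a n1_even) //.
Qed.

Lemma alive_prob_ge m : (n1 <= m)%N ->
  A n1 / ((s * q + s + 2) + (s * q + s + 2) * m).+1%:R <= A m.
Proof.
(* The block index [q + m] ends after time [m], and [alive] is decreasing in time. *)
move=> nm; have qm : (q <= q + m)%N by rewrite leq_addr.
have := expect_potential_bound qm; set M := (s * (q + m)).+2.
have mM : (m <= M)%N by rewrite !leqW // mulnDr (leq_trans _ (leq_addl _ _)) // leq_pmull.
have AM : A M <= A m.
  rewrite -lee_fin -!AE ?(leq_trans nm) //; apply: le_measure; rewrite ?inE.
  - by apply: measurable_alive; apply: leq_trans mM.
  - exact: measurable_alive.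
  - by move=> w /=; apply: alive_mono; rewrite nm mM.
have A0 : 0 <= A m by rewrite fine_ge0.
move=> h; rewrite ler_pdivrMr ?ltr0n // mulrC; apply: le_trans h _.
apply: ler_pM => //; first by rewrite fine_ge0.
by rewrite ler_nat /M; nia.
Qed.

(** The hitting time dominates the number of times at which [alive] holds, and the probabilities of
    these events are bounded below by a divergent series of harmonic type. *)
Lemma expected_hitting_infty :
  (\int[P]_(w in state_event s T0 xi X n1 T a) hitting_time X n1 r w = +oo)%E.
Proof.
set B := state_event _ _ _ _ _ _ _; have mB : measurable B by exact: measurable_state.
have An1 : 0 < A n1 by rewrite -lte_fin -AE.
apply/eqP; rewrite -leye_eq leNgt; apply/negP => fin.
have hB0 : (0 <= \int[P]_(w in B) hitting_time X n1 r w)%E.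
  by apply: integral_ge0 => w _; exact: hitting_time_ge0.
have [K KE] : exists K : R, (\int[P]_(w in B) hitting_time X n1 r w = K%:E)%E.
  by exists (fine (\int[P]_(w in B) hitting_time X n1 r w)%E); rewrite fineK // ge0_fin_numE.
have [N hN] := @inverse_linear_unbounded R n1 (A n1) (s * q + s + 2) An1 (K + 1).
suff : K + 1 <= K by rewrite gerDl ler10.
apply: le_trans hN _; rewrite -lee_fin -KE.
pose c k x : R := \sum_(n1 <= m < N) (alive m k x)%:R.
apply: (@le_trans _ _ (\sum_(n1 <= m < N) P [set w | path (alive m) w])%E).
  rewrite (eq_big_nat _ _ (F2 := fun m => (A m)%:E)); last by move=> m /andP[nm _]; rewrite AE.
  rewrite sumEFin lee_fin big_nat_cond [leRHS]big_nat_cond.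
  by apply: ler_sum => m /andP[/andP[nm _] _]; exact: alive_prob_ge.
pose S i := [set w | path (alive (i + n1)) w].
have mS i : measurable (S i) by apply: measurable_alive; exact: leq_addl.
have SB i : S i `<=` B.
  move=> w /= /(@alive_mono n1 (i + n1)); rewrite leqnn leq_addl => /(_ isT).
  by rewrite alive_start // => /and4P[_ _ /asboolP eT /eqP ea]; split.
rewrite -{1}[n1]add0n big_addn.
rewrite (eq_bigr (fun i => \int[P]_(w in B) (\1_(S i) w)%:E)%E); last first.
  by move=> i _; rewrite integral_indic // setIidl //; exact: SB.
rewrite -ge0_integral_sum //; last first.
  by move=> i; apply/measurable_EFinP; exact: measurable_funTS.
apply: ge0_le_integral => //.
- by move=> w _; apply: sume_ge0 => i _; rewrite lee_fin.
- apply: emeasurable_sum => i; apply/measurable_EFinP; exact: measurable_funTS.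
- by apply: measurable_funTS; exact: (measurable_hitting_time xi X).
move=> w _; elim: (N - n1)%N => [|M IH].
  by rewrite big_geq // hitting_time_ge0.
(* If [S M] holds, the root is not hit within [M] steps, so the hitting time is at least [M.+1], the
   number of summands; otherwise the last summand is 0. *)
have [SM|SM] := pselect (S M w); last first.
  by rewrite big_nat_recr //= indicE memNset // adde0.
apply: le_trans (_ : (M.+1%:R%:E <= _)%E); last first.
  apply: hitting_time_ge => i /andP[ni iM]; apply: (alive_neq SM).
  by rewrite ltnW //= addnC.
rewrite sumEFin lee_fin (le_trans (_ : _ <= \sum_(0 <= i < M.+1) 1)) //.
  by apply: ler_sum => i _; rewrite indicE; case: (w \in _).
by rewrite sumr_const_nat subn0.
Qed.

End Excursion.

Lemma tbrw_not_positive_recurrent : ~ positive_recurrent s T0 xi X.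
Proof.
have [k [k0 kpos]] := positive_env.
(* The height at which the gain [kappa * D] satisfies the requirement of [potential_blocks]. *)
pose D := (Num.bound (2 ^+ s.+1 / kappa)).+1.
have hD : 2 ^+ s.+1 <= kappa * D%:R.
  rewrite mulrC -ler_pdivrMr // ltW // (lt_le_trans (archi_boundP _)) //.
    by rewrite divr_ge0 // ltW.
  by rewrite ler_nat.
have [q [T [a [[x [e0 hw eT ex]] [H [hH Ha HD]] nar fanT degT]]]] :=
  reach_deep_fan s0 s_even k0 hT0 hx0 (ltn0Sn _ : (0 < D)%N).
set n1 := (s * q).+2 in hw eT ex *.
have [bT haT] : bridged_tree r T /\ (a < nverts T)%N.
  by rewrite -eT -ex; apply: (walk_treeP hT0 _ hw (leqnn _)); rewrite e0.
have sub : fiber xi X n1 n1.+1 k x `<=`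
    [set w | path (alive s T0 x0 r n1 T a n1) w].
  move=> w [h1 h2] /=; rewrite (adapted_alive s T0 x0 r T a (leqnn n1) h1 h2) alive_start //.
  apply/and4P; split; [exact/eqP| |exact/asboolP|exact/eqP].
  by apply/allP => i; rewrite mem_iota => /andP[_ hi]; exact: hw.
have PA : (0 < P [set w | path (alive s T0 x0 r n1 T a n1) w])%E.
  apply: lt_le_trans (prob_reach_gt0 kpos e0 hw) _.
  apply: le_measure; rewrite ?inE //; first exact: measurable_fiber.
  exact: (measurable_path_bool xi X (adapted_alive s T0 x0 r T a (leqnn n1))).
have PB : (0 < P (state_event s T0 xi X n1 T a))%E.
  apply: lt_le_trans PA _; apply: le_measure; rewrite ?inE.
  - exact: (measurable_path_bool xi X (adapted_alive s T0 x0 r T a (leqnn n1))).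
  - exact: measurable_state.
  - by move=> w /=; rewrite alive_start // => /and4P[_ _ /asboolP ? /eqP ?]; split.
have rT : (r < nverts T)%N by have [] := bT.
move=> [_ /(_ n1 T a r PB rT)].
rewrite /cond_expectation (expected_hitting_infty haT nar hH Ha HD fanT degT hD PA).
rewrite gt0_mulye // lte_fin invr_gt0 fine_gt0 // PB /= ltey_eq fin_num_measure //.
exact: measurable_state.
Qed.

End NotPositive.

Theorem proposition1p2 (R : realType) (d : measure_display)
    (Omega : measurableType d) (P : probability Omega R)
    (s : nat) (xi : nat -> {RV P >-> nat})
    (hs2 : (2 <= s)%N) (hseven : ~~ odd s)
    (hindep : mutually_independent xi)
    (c : R) (g : nat -> R) (hc : 0 < c)
    (hg : forall n, (1 <= n)%N -> 0 < g n)
    (hgdiv : (\sum_(1 <= n <oo) ((g n)^-1)%:E)%E = +oo%E)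
    (hlimsup :
      P [set w | (limn_esup (fun n => ((env_sum s xi n w)%:R / g n)%:E)
                    <= c%:E)%E] = 1%E)
    (kappa : R) (hkappa : 0 < kappa)
    (hinf : ereal_inf (range (fun n => P [set w | (1 <= xi n w)%N]))
              = kappa%:E)
    (T0 : graph) (x0 : nat) (hT0 : is_rooted_tree T0)
    (hx0 : (x0 < nverts T0)%N)
    (X : nat -> {RV P >-> nat}) (hX : is_TBRW s T0 x0 xi X) :
  null_recurrent s T0 xi X.
Proof.
have [r hr] := rooted_tree_bridged hT0.
have s0 : (0 < s)%N by exact: ltnW.
have hkappa_le m : (kappa%:E <= P (xi m @^-1` [set j | (0 < j)%N]))%E.
  by rewrite -hinf; apply: ereal_inf_lbound; exists m.
split; first exact: (tbrw_recurrent hX s0 hseven hr hx0 hc hg hgdiv hlimsup).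
exact: (tbrw_not_positive_recurrent hindep hX s0 hseven hr hx0 hkappa hkappa_le).
Qed.
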